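(* Let $q\in\mathbf{C}^\times$ and let $(\Omega^\bullet_q(S^2),\ \mathrm{d}=\partial+\overline{\partial})$ be the $q$-deformed Dolbeault double complex of the standard Podleś sphere, with codifferentials $\mathrm{d}^*,\partial^*,\overline{\partial}^*$, Dirac operators $D_{\mathrm{d}}=\mathrm{d}+\mathrm{d}^*$, $D_\partial=\partial+\partial^*$, $D_{\overline{\partial}}=\overline{\partial}+\overline{\partial}^*$, and Laplacians $\Delta_{\mathrm{d}}=D_{\mathrm{d}}^2$, $\Delta_\partial=D_\partial^2$, $\Delta_{\overline{\partial}}=D_{\overline{\partial}}^2$. Write $\mathcal{H}_{\mathrm{d}}=\ker\Delta_{\mathrm{d}}$, $\mathcal{H}_\partial=\ker\Delta_\partial$, $\mathcal{H}_{\overline{\partial}}=\ker\Delta_{\overline{\partial}}$. Then: 1. The Dirac operators $D_{\mathrm{d}}, D_\partial, D_{\overline{\partial}}$ and the Laplacians $\Delta_{\mathrm{d}},\Delta_\partial,\Delta_{\overline{\partial}}$ on $\Omega^\bullet_q(S^2)$ are diagonalisable. 2. (a) $\ker(\Delta_{\mathrm{d}})=\ker(D_{\mathrm{d}})=\ker(\mathrm{d})\cap\ker(\mathrm{d}^* )$; (b) $\ker(\Delta_\partial)=\ker(D_\partial)=\ker(\partial)\cap\ker(\partial^* )$; (c) $\ker(\Delta_{\overline{\partial}})=\ker(D_{\overline{\partial}})=\ker(\overline{\partial})\cap\ker(\overline{\partial}^* )$. 3. There are decompositions (a) $\Omega^\bullet_q(S^2)=\mathcal{H}_{\mathrm{d}}\oplus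 \mathrm{d}(\Omega^\bullet_q(S^2))\oplus \mathrm{d}^*(\Omega^\bullet_q(S^2))$, (b) $\Omega^\bullet_q(S^2)=\mathcal{H}_\partial\oplus \partial(\Omega^\bullet_q(S^2))\oplus \partial^*(\Omega^\bullet_q(S^2))$, (c) $\Omega^\bullet_q(S^2)=\mathcal{H}_{\overline{\partial}}\oplus \overline{\partial}(\Omega^\bullet_q(S^2))\oplus \overline{\partial}^*(\Omega^\bullet_q(S^2))$.
   Context: Algebra. $q\in\mathbf{C}^\times$. $\mathbf{C}_q[SU_2]$ is the Hopf $*$-algebra generated by $a,b,c,d$ with $ab=qba$, $ac=qca$, $bd=qdb$, $cd=qdc$, $bc=cb$, $ad-da=(q-q^{-1})bc$, $ad-qbc=1$; coproduct $\Delta(a)=a\otimes a+b\otimes c$, $\Delta(b)=a\otimes b+b\otimes d$, $\Delta(c)=c\otimes a+d\otimes c$, $\Delta(d)=c\otimes b+d\otimes d$; counit $\varepsilon(a)=\varepsilon(d)=1$, $\varepsilon(b)=\varepsilon(c)=0$; and $a^*=d$, $d^*=a$, $b^*=-qc$, $c^*=-q^{-1}b$. It is $\mathbf{Z}$-graded by $\deg a=\deg c=-1$, $\deg b=\deg d=1$; $\mathcal{E}_k$ is the degree-$k$ part. The Podleś sphere is $M=\mathbf{C}_q[S^2]=\mathcal{E}_0$, generated by $b_-=ab$, $b_0=bc$, $b_+=cd$; $\Delta_L:M\to\mathbf{C}_q[SU_2]\otimes M$ is the coaction given by the coproduct, and $M^+=M\cap\ker\varepsilon$. Calculus. A total differential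 calculus over $M$ is a graded algebra $\Omega^\bullet=\bigoplus_{k\ge0}\Omega^k$ with $\Omega^0=M$ and a degree-one map $\mathrm{d}$ with $\mathrm{d}^2=0$ satisfying the graded Leibniz rule, such that $\Omega^k$ is spanned by the $m_0\mathrm{d}m_1\wedge\cdots\wedge \mathrm{d}m_k$; it is a $*$-calculus if $*$ extends to a conjugate-linear involution with $(\mathrm{d}\omega)^*=\mathrm{d}\omega^*$ and $(\omega\wedge\nu)^*=(-1)^{kl}\nu^*\wedge\omega^*$ for forms of degrees $k,l$; it is covariant if $\Delta_L$ extends to a left coaction on $\Omega^\bullet$ with $\Delta_L\mathrm{d}=(\mathrm{id}\otimes \mathrm{d})\Delta_L$. An almost complex structure on a $*$-calculus is an $\mathbf{N}_0^2$-algebra grading $\Omega^{(p,r)}$ with $\Omega^k=\bigoplus_{p+r=k}\Omega^{(p,r)}$, $(\Omega^{(p,r)})^*=\Omega^{(r,p)}$, and $\wedge$ restricting to isomorphisms $\Omega^{(p,0)}\otimes_M\Omega^{(0,r)}\to\Omega^{(p,r)}$ and $\Omega^{(0,r)}\otimes_M\Omega^{(p,0)}\to\Omega^{(p,r)}$; it is covariant if $\Delta_L$ preserves each $\Omega^{(p,r)}$. $\Omega^\bullet_q(S^2)$ is the unique covariant total differential calculus over $M$ whose 1-forms have classical dimension and which admits a covariant almost complex structure; that structure is unique and integrable, so $\mathrm{d}=\partial+\overline{\partial}$ with $\partial$, $\overline{\partial}$ of bidegrees $(1,0)$, $(0,1)$. Identifying a form $\omega$ with $\omega_{(-1)}\otimes[\omega_{(0)}]$,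 where $\Delta_L\omega=\omega_{(-1)}\otimes\omega_{(0)}$ and $[\cdot]$ is the class modulo $M^+\Omega^\bullet$, and putting $e^\pm=[\mathrm{d}b_\pm]$, $\tau=[\mathrm{d}b_+\wedge \mathrm{d}b_-]$, one has $\Omega^{(1,0)}=\mathcal{E}_2e^+$, $\Omega^{(0,1)}=\mathcal{E}_{-2}e^-$, $\Omega^2=\Omega^{(1,1)}=\mathcal{E}_0\tau$, $\Omega^k=0$ for $k>2$, and for $f,f'\in\mathcal{E}_2$, $g,g'\in\mathcal{E}_{-2}$: $(fe^+)\wedge(ge^-)=fg\,\tau$, $(ge^-)\wedge(fe^+)=-q^2gf\,\tau$, $(fe^+)\wedge(f'e^+)=0=(ge^-)\wedge(g'e^-)$. Hodge map. $\ast_H(m)=m\tau$, $\ast_H(m\tau)=m$, $\ast_H(fe^+)=i\,fe^+$, $\ast_H(ge^-)=-i\,ge^-$ for $m\in\mathcal{E}_0$, $f\in\mathcal{E}_2$, $g\in\mathcal{E}_{-2}$. Codifferentials. $\mathrm{d}^*=-\ast_H\mathrm{d}\,\ast_H$, $\partial^*=-\ast_H\overline{\partial}\,\ast_H$, $\overline{\partial}^*=-\ast_H\partial\,\ast_H$. *)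

(* Defs.v *)
From HB Require Import structures.
From mathcomp Require Import all_boot all_order all_algebra.
From mathcomp Require Import sesquilinear.
From mathcomp Require Export complex.
From mathcomp Require Export boolp classical_sets.
From mathcomp Require Export reals.

Set Implicit Arguments.
Unset Strict Implicit.
Unset Printing Implicit Defensive.

Import Order.TTheory GRing.Theory Num.Theory.

Local Open Scope classical_set_scope.
Local Open Scope ring_scope.

Section LinearAlgebra.
Variable C : numClosedFieldType.

Definition subspace (V : lmodType C) (P : set V) : Prop :=
  P 0 /\ forall (k : C) (v w : V), P v -> P w -> P (k *: v + w).

(* V is the internal direct sum of the (possibly infinite) family P. *)
Definition direct_sum (V : lmodType C) (I : choiceType) (P : I -> set V) :
  Prop :=
  [/\ forall i, subspace (P i),
      forall v, exists (s : seq I) (w : I -> V),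
        [/\ uniq s, forall i, P i (w i) & v = \sum_(i <- s) w i]
    & forall (s : seq I) (w : I -> V), uniq s -> (forall i, P i (w i)) ->
        \sum_(i <- s) w i = 0 -> forall i, i \in s -> w i = 0].

Definition kernel (V W : lmodType C) (f : V -> W) : set V :=
  [set v | f v = 0].

Definition eigenspace (V : lmodType C) (f : V -> V) (z : C) : set V :=
  [set v | f v = z *: v].

Definition diagonalisable (V : lmodType C) (f : V -> V) : Prop :=
  direct_sum (eigenspace f).

Definition direct_sum3 (V : lmodType C) (P Q T : set V) : Prop :=
  direct_sum (fun i : 'I_3 => nth set0 [:: P; Q; T] i).

(* An element of the tensor product over C of U and V is represented by a    *)
(* finite list of pure tensors.  Two lists represent the same element of the *)
(* tensor product of U and V / N when every bilinear map that vanishes on    *)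
(* U x N takes the same value on both; N = {0} gives the tensor product of U *)
(* and V.                                                                    *)
Definition tens_eq_mod (U V : lmodType C) (N : set V) (s t : seq (U * V)) :
  Prop :=
  forall (W : lmodType C) (f : U -> V -> W),
    bilinear_for *:%R *:%R f -> (forall u v, N v -> f u v = 0) ->
    \sum_(p <- s) f p.1 p.2 = \sum_(p <- t) f p.1 p.2.

Definition tens_eq (U V : lmodType C) (s t : seq (U * V)) : Prop :=
  tens_eq_mod [set 0] s t.

Definition tens_scale (U V : lmodType C) (k : C) (s : seq (U * V)) :=
  [seq (k *: p.1, p.2) | p <- s].

Definition tens_mul (A B : algType C) (s t : seq (A * B)) : seq (A * B) :=
  [seq (p.1 * r.1, p.2 * r.2) | p <- s, r <- t].

Definition tens_map (U V U' V' : lmodType C) (f : U -> U') (g : V -> V')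
    (s : seq (U * V)) : seq (U' * V') :=
  [seq (f p.1, g p.2) | p <- s].

Definition trilinear (U V T W : lmodType C) (f : U -> V -> T -> W) : Prop :=
  (forall u, bilinear_for *:%R *:%R (f u)) /\
  (forall v t, linear (fun u => f u v t)).

Definition conj_linear (V : lmodType C) (f : V -> V) : Prop :=
  forall (k : C) (v w : V), f (k *: v + w) = Num.conj k *: f v + f w.

Definition left_coaction (A : algType C) (Delta : A -> seq (A * A))
    (eps : A -> C) (V : lmodType C) (delta : V -> seq (A * V)) : Prop :=
  [/\ forall (k : C) (v w : V),
        tens_eq (delta (k *: v + w)) (tens_scale k (delta v) ++ delta w),
      forall v : V, \sum_(p <- delta v) eps p.1 *: p.2 = v
    & forall (v : V) (W : lmodType C) (f : A -> A -> V -> W), trilinear f ->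
        \sum_(p <- delta v) \sum_(r <- Delta p.1) f r.1 r.2 p.2 =
        \sum_(p <- delta v) \sum_(r <- delta p.2) f p.1 r.1 r.2].

End LinearAlgebra.

Section QuantumGroup.
Variables (C : numClosedFieldType) (q : C).

Definition q_relations (B : algType C) (a b c d : B) : Prop :=
  [/\ [/\ a * b = q *: (b * a), a * c = q *: (c * a),
          b * d = q *: (d * b) & c * d = q *: (d * c)],
      b * c = c * b,
      a * d - d * a = (q - q^-1) *: (b * c)
    & a * d - q *: (b * c) = 1].

(* qg_generation is the universal property of the algebra presented by the  *)
(* generators and relations, so the record determines the Hopf star-algebra *)
(* up to unique isomorphism.                                                *)
Record CqSU2 := MkCqSU2 {
  qg_alg :> algType C;
  qg_a : qg_alg; qg_b : qg_alg; qg_c : qg_alg; qg_d : qg_alg;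
  qg_relations : q_relations qg_a qg_b qg_c qg_d;
  qg_generation : forall (B : algType C) (a b c d : B),
    q_relations a b c d ->
    exists f : {lrmorphism qg_alg -> B},
      [/\ f qg_a = a, f qg_b = b, f qg_c = c & f qg_d = d] /\
      forall g : {lrmorphism qg_alg -> B},
        [/\ g qg_a = a, g qg_b = b, g qg_c = c & g qg_d = d] -> g =1 f;
  qg_Delta : qg_alg -> seq (qg_alg * qg_alg);
  qg_eps : {lrmorphism qg_alg -> C^o};
  qg_star : qg_alg -> qg_alg;
  qg_Delta_coaction : left_coaction qg_Delta qg_eps qg_Delta;
  qg_Delta_counitr : forall x,
    \sum_(p <- qg_Delta x) (qg_eps p.2 : C) *: p.1 = x;
  qg_Delta1 : tens_eq (qg_Delta 1) [:: (1, 1)];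
  qg_DeltaM : forall x y,
    tens_eq (qg_Delta (x * y)) (tens_mul (qg_Delta x) (qg_Delta y));
  qg_Delta_gen :
    [/\ tens_eq (qg_Delta qg_a) [:: (qg_a, qg_a); (qg_b, qg_c)],
        tens_eq (qg_Delta qg_b) [:: (qg_a, qg_b); (qg_b, qg_d)],
        tens_eq (qg_Delta qg_c) [:: (qg_c, qg_a); (qg_d, qg_c)]
      & tens_eq (qg_Delta qg_d) [:: (qg_c, qg_b); (qg_d, qg_d)]];
  qg_eps_gen : [/\ qg_eps qg_a = 1, qg_eps qg_b = 0,
                   qg_eps qg_c = 0 & qg_eps qg_d = 1];
  qg_antipode : exists S : {linear qg_alg -> qg_alg}, forall x,
    \sum_(p <- qg_Delta x) S p.1 * p.2 = (qg_eps x : C) *: 1 /\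
    \sum_(p <- qg_Delta x) p.1 * S p.2 = (qg_eps x : C) *: 1;
  qg_star_conj : conj_linear qg_star;
  qg_starK : involutive qg_star;
  qg_starM : forall x y, qg_star (x * y) = qg_star y * qg_star x;
  qg_star_Delta : forall x,
    tens_eq (qg_Delta (qg_star x)) (tens_map qg_star qg_star (qg_Delta x));
  qg_star_gen :
    [/\ qg_star qg_a = qg_d, qg_star qg_d = qg_a,
        qg_star qg_b = - q *: qg_c & qg_star qg_c = - q^-1 *: qg_b]
}.

Variable A : CqSU2.

(* The degree-k part E_k: the span of the monomials in a, b, c, d of total *)
(* degree k.                                                               *)
Inductive degree_part : int -> A -> Prop :=
| degree_part0 k : degree_part k 0
| degree_partD k (z : C) x y : degree_part k x -> degree_part k y ->
    degree_part k (z *: x + y)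
| degree_part1 : degree_part 0 1
| degree_partM k l x y : degree_part k x -> degree_part l y ->
    degree_part (k + l) (x * y)
| degree_part_a : degree_part (-1) (qg_a A)
| degree_part_b : degree_part 1 (qg_b A)
| degree_part_c : degree_part (-1) (qg_c A)
| degree_part_d : degree_part 1 (qg_d A).

Definition podles_pred : pred A := fun x => `[< degree_part 0 x >].

Record podles := Podles {
  podles_val :> A;
  podles_deg : podles_pred podles_val
}.

HB.instance Definition _ := [isSub of podles for podles_val].
HB.instance Definition _ := [Choice of podles by <:].

Fact podles_closed : GRing.subsemialg_closed podles_pred.
Proof.
apply: GRing.subalg_closed_semi; split.
- exact/asboolP/degree_part1.
- move=> z x y /asboolP Hx /asboolP Hy; exact/asboolP/degree_partD.
- move=> x y /asboolP Hx /asboolP Hy; apply/asboolP.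
  exact: (degree_partM Hx Hy).
Qed.

HB.instance Definition _ := GRing.isSubalgClosed.Build C A podles_pred
  podles_closed.
HB.instance Definition _ := [SubChoice_isSubAlgebra of podles by <:].

Definition podles_eps (m : podles) : C := qg_eps A (\val m).

Fact podles_bm_subproof : podles_pred (qg_a A * qg_b A).
Proof. exact/asboolP/(degree_partM (degree_part_a) (degree_part_b)). Qed.

Fact podles_bp_subproof : podles_pred (qg_c A * qg_d A).
Proof. exact/asboolP/(degree_partM (degree_part_c) (degree_part_d)). Qed.

Definition podles_bm : podles := Podles podles_bm_subproof.
Definition podles_bp : podles := Podles podles_bp_subproof.

End QuantumGroup.

Section Calculus.
Variables (C : numClosedFieldType) (q : C) (A : CqSU2 q).

Local Notation M := (podles A).
Local Notation E := (@degree_part C q A).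

(* A total differential calculus over M; cl_in is the identification of M *)
(* with the forms of degree 0.                                            *)
Record calculus := MkCalculus {
  cl_alg :> algType C;
  cl_form : nat -> set cl_alg;
  cl_in : {lrmorphism M -> cl_alg};
  cl_d : {linear cl_alg -> cl_alg};
  cl_grading : direct_sum cl_form;
  cl_formM : forall k l w v,
    cl_form k w -> cl_form l v -> cl_form (k + l)%N (w * v);
  cl_in_inj : injective cl_in;
  cl_form0 : cl_form 0%N = range cl_in;
  cl_d_form : forall k w, cl_form k w -> cl_form k.+1 (cl_d w);
  cl_dd : forall w, cl_d (cl_d w) = 0;
  cl_leibniz : forall k w v, cl_form k w ->
    cl_d (w * v) = cl_d w * v + (-1) ^+ k *: (w * cl_d v);
  cl_total : forall k w, cl_form k w ->
    exists s : seq (M * k.-tuple M),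
      w = \sum_(p <- s) cl_in p.1 * \prod_(m <- p.2) cl_d (cl_in m)
}.

Variable Om : calculus.

Definition is_star (st : Om -> Om) : Prop :=
  [/\ conj_linear st, involutive st,
      forall m m' : M, \val m' = qg_star (\val m) ->
        st (cl_in Om m) = cl_in Om m',
      forall w, st (cl_d Om w) = cl_d Om (st w)
    & forall k l w v, cl_form k w -> cl_form l v ->
        st (w * v) = (-1) ^+ (k * l) *: (st v * st w)].

(* In the clause on M, the list s runs over the representatives of the      *)
(* coproduct of m whose second legs lie in M: the coaction on M is the      *)
(* coproduct, and delta extends it.                                         *)
Definition is_covariant (delta : Om -> seq (A * Om)) : Prop :=
  [/\ left_coaction (@qg_Delta _ _ A) (qg_eps A) delta,
      forall (m : M) (s : seq (A * M)),
        tens_eq (qg_Delta (\val m)) [seq (p.1, \val p.2) | p <- s] ->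
        tens_eq (delta (cl_in Om m)) [seq (p.1, cl_in Om p.2) | p <- s],
      forall w v, tens_eq (delta (w * v)) (tens_mul (delta w) (delta v))
    & forall w, tens_eq (delta (cl_d Om w)) (tens_map id (cl_d Om) (delta w))].

(* The wedge map from the tensor product of P and Q over M onto T is an      *)
(* isomorphism.  Injectivity: a formal sum of pure tensors that is sent to 0 *)
(* is killed by every M-balanced bilinear map on P x Q, so it is 0 in the    *)
(* tensor product over M.                                                    *)
Definition balanced (P Q : set Om) (W : lmodType C) (f : Om -> Om -> W) :
  Prop :=
  [/\ forall (k : C) w w' v, P w -> P w' -> Q v ->
        f (k *: w + w') v = k *: f w v + f w' v,
      forall (k : C) w v v', P w -> Q v -> Q v' ->
        f w (k *: v + v') = k *: f w v + f w v'
    & forall w (m : M) v, P w -> Q v ->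
        f (w * cl_in Om m) v = f w (cl_in Om m * v)].

Definition wedge_iso (P Q T : set Om) : Prop :=
  [/\ forall w v, P w -> Q v -> T (w * v),
      forall w, T w -> exists s : seq (Om * Om),
        (forall p, p \in s -> P p.1 /\ Q p.2) /\ w = \sum_(p <- s) p.1 * p.2
    & forall s : seq (Om * Om),
        (forall p, p \in s -> P p.1 /\ Q p.2) -> \sum_(p <- s) p.1 * p.2 = 0 ->
        forall (W : lmodType C) (f : Om -> Om -> W), balanced P Q f ->
          \sum_(p <- s) f p.1 p.2 = 0].

Definition is_almost_complex (st : Om -> Om) (bi : nat -> nat -> set Om) :
  Prop :=
  [/\ direct_sum (fun pr : nat * nat => bi pr.1 pr.2),
      forall p r p' r' w v, bi p r w -> bi p' r' v ->
        bi (p + p')%N (r + r')%N (w * v),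
      forall k (w : Om), cl_form k w <->
        exists u : 'I_k.+1 -> Om,
          (forall p : 'I_k.+1, bi p (k - p)%N (u p)) /\ w = \sum_(p < k.+1) u p,
      forall p r, st @` bi p r = bi r p
    & forall p r, wedge_iso (bi p 0%N) (bi 0%N r) (bi p r) /\
                  wedge_iso (bi 0%N r) (bi p 0%N) (bi p r)].

Definition is_covariant_complex (delta : Om -> seq (A * Om))
    (bi : nat -> nat -> set Om) : Prop :=
  forall p r w, bi p r w -> exists s : seq (A * Om),
    (forall u, u \in s -> bi p r u.2) /\ tens_eq (delta w) s.

(* M^+ P, the span of the products of elements of M^+ and elements of P. *)
Definition Mplus_span (P : set Om) : set Om :=
  [set w | exists s : seq (M * Om),
     (forall p, p \in s -> podles_eps p.1 = 0 /\ P p.2) /\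
     w = \sum_(p <- s) cl_in Om p.1 * p.2].

(* The space Omega^1 / M^+ Omega^1 is 2-dimensional. *)
Definition classical_dimension : Prop :=
  exists e1 e2 : Om, [/\ cl_form 1%N e1, cl_form 1%N e2
    & forall w, cl_form 1%N w -> exists! z : C * C,
        Mplus_span (cl_form (c := Om) 1%N) (w - (z.1 *: e1 + z.2 *: e2))].

(* Under the identification of w with w_(-1) (x) [w_(0)], the form w is    *)
(* f [x], where [x] is the class of x modulo M^+ Omega.                    *)
Definition is_coord (delta : Om -> seq (A * Om)) (f : A) (x w : Om) : Prop :=
  tens_eq_mod (Mplus_span setT) (delta w) [:: (f, x)].

Definition is_line (delta : Om -> seq (A * Om)) (k : int) (x : Om)
    (S : set Om) : Prop :=
  [/\ forall f, E k f -> exists2 w, S w & is_coord delta f x w,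
      forall w, S w -> exists2 f, E k f & is_coord delta f x w
    & forall f f' w, is_coord delta f x w -> is_coord delta f' x w -> f = f'].

End Calculus.

Section Dolbeault.
Variables (C : numClosedFieldType) (q : C) (A : CqSU2 q).

Local Notation E := (@degree_part C q A).

Definition e_plus (Om : calculus A) : Om :=
  cl_d Om (cl_in Om (podles_bp A)).
Definition e_minus (Om : calculus A) : Om :=
  cl_d Om (cl_in Om (podles_bm A)).
Definition form_tau (Om : calculus A) : Om := e_plus Om * e_minus Om.

(* e_plus, e_minus and form_tau are representatives of the classes e^+, e^- *)
(* and tau; they only occur through is_coord, which depends on the classes. *)
Record dolbeault_complex := MkDolbeault {
  db_cl :> calculus A;
  db_star : db_cl -> db_cl;
  db_delta : db_cl -> seq (A * db_cl);
  db_bi : nat -> nat -> set db_cl;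
  db_del : {linear db_cl -> db_cl};
  db_delbar : {linear db_cl -> db_cl};
  db_is_star : is_star db_star;
  db_covariant : is_covariant db_delta;
  db_dim : classical_dimension db_cl;
  db_almost_complex : is_almost_complex db_star db_bi;
  db_covariant_complex : is_covariant_complex db_delta db_bi;
  db_d_split : forall w, cl_d db_cl w = db_del w + db_delbar w;
  db_del_bi : forall p r w, db_bi p r w -> db_bi p.+1 r (db_del w);
  db_delbar_bi : forall p r w, db_bi p r w -> db_bi p r.+1 (db_delbar w);
  db_identification : forall w,
    tens_eq_mod (Mplus_span setT) (db_delta w) [::] -> w = 0;
  db_form10 : is_line db_delta 2 (e_plus db_cl) (db_bi 1 0);
  db_form01 : is_line db_delta (-2) (e_minus db_cl) (db_bi 0 1);
  db_form11 : is_line db_delta 0 (form_tau db_cl) (db_bi 1 1);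
  db_form2 : cl_form (c := db_cl) 2 = db_bi 1 1;
  db_form_gt2 : forall k, (2 < k)%N -> cl_form (c := db_cl) k = [set 0];
  db_wedge_pm : forall f g w v, E 2 f -> E (- 2) g ->
    is_coord db_delta f (e_plus db_cl) w ->
    is_coord db_delta g (e_minus db_cl) v ->
    is_coord db_delta (f * g) (form_tau db_cl) (w * v) /\
    is_coord db_delta (- q ^+ 2 *: (g * f)) (form_tau db_cl) (v * w);
  db_wedge_pp : forall f f' w v, E 2 f -> E 2 f' ->
    is_coord db_delta f (e_plus db_cl) w ->
    is_coord db_delta f' (e_plus db_cl) v -> w * v = 0;
  db_wedge_mm : forall g g' w v, E (- 2) g -> E (- 2) g' ->
    is_coord db_delta g (e_minus db_cl) w ->
    is_coord db_delta g' (e_minus db_cl) v -> w * v = 0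
}.

Variable Om : dolbeault_complex.

Definition is_hodge (h : Om -> Om) : Prop :=
  [/\ forall m : podles A,
        is_coord (@db_delta Om) (\val m) (form_tau Om) (h (cl_in Om m)),
      forall (m : podles A) w,
        is_coord (@db_delta Om) (\val m) (form_tau Om) w -> h w = cl_in Om m,
      forall f w, E 2 f -> is_coord (@db_delta Om) f (e_plus Om) w ->
        h w = 'i *: w
    & forall g w, E (- 2) g -> is_coord (@db_delta Om) g (e_minus Om) w ->
        h w = - 'i *: w].

(* The codifferential is d^* for delta = d, del^* for delta = delbar, and *)
(* delbar^* for delta = del.                                              *)
Definition codiff (h delta : Om -> Om) (w : Om) : Om := - h (delta (h w)).

Definition dirac (delta deltas : Om -> Om) (w : Om) : Om :=
  delta w + deltas w.

Definition laplacian (delta deltas : Om -> Om) (w : Om) : Om :=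
  dirac delta deltas (dirac delta deltas w).

End Dolbeault.

(* Main.v *)
Require Import Defs.
From mathcomp Require Import all_boot all_order all_algebra.
From HB Require Import structures.
From mathcomp Require Import sesquilinear ring boolp classical_sets.

Set Implicit Arguments.
Unset Strict Implicit.
Unset Printing Implicit Defensive.

Import Order.TTheory GRing.Theory Num.Theory.
Local Open Scope classical_set_scope.
Local Open Scope ring_scope.

(** The Dolbeault complex of the Podles sphere behaves like that of a compact
    Kaehler curve.  The three Laplacians agree up to a factor 2, and commute
    with del, delbar and the Hodge map.  Let L be the restriction of the
    del-Laplacian to M = E_0.  The statement about all forms follows from three
    facts: L is diagonalisable, its kernel is killed by del and delbar, and
    every (1,0)-form is del of a function and every (0,1)-form delbar of a
    function.  Indeed the four bidegrees are then obtained from M by del,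
    delbar and the Hodge map, so that eigenvectors of L give eigenvectors of
    all Laplacians; this is kaehler_hodge_theory.  A Dirac operator D with
    diagonalisable square, vanishing on the kernel of its square, is
    diagonalisable because the eigenspace of D^2 for a nonzero eigenvalue splits
    along its two square roots.

    In coordinates, del and delbar are, up to scalars, the raising and lowering
    operators E and F of quantum sl_2: del m = q^-1 E(m) e^+ and
    delbar m = F(m) e^- on M, and delbar (f e^+) = - F(f) tau.  Hence L is a
    multiple of FE, and the three facts are statements about the algebra A with
    its Z-grading, on which q^2 EF - FE is a q-integer in each degree and E and
    F are locally nilpotent.  They follow by the theory of sl_2-strings: if
    E^(n+1) v = 0, then E^n kills (FE - c_n) v for an explicit scalar c_n, and
    the scalars c_0, c_1, ... increase strictly because q is real.  That q is
    real is forced by the star structure.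

    The operators E and F are built from the presentation of A.  The
    identification with del and delbar uses covariance: on the comodule spanned
    by 1, b_-, b_0, b_+, a covariant map is determined by the counits of its
    values, and the target degree forces all but one of them to vanish.
    The remaining scalar is fixed by the normalisation of e^+ and e^- for del and
    delbar, and by one relation between b_- del b_+ and del b_0 for delbar del. *)

(** * Sums of eigenvectors *)

Section EigenvectorSums.
Variables (C : numClosedFieldType) (V : lmodType C).
Implicit Types (f : V -> V) (P : set V) (v w : V).

(** Diagonalisability one vector at a time.  Eigenvalues may repeat, which
    makes closure under sums and under intertwining maps immediate. *)
Inductive eigen_sum P f : V -> Prop :=
| eigen_sum0 : eigen_sum P f 0
| eigen_sum_add z v w : P v -> f v = z *: v -> eigen_sum P f w ->
    eigen_sum P f (v + w).

Lemma eigen_sumD P f v w :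
  eigen_sum P f v -> eigen_sum P f w -> eigen_sum P f (v + w).
Proof.
move=> vs ws; elim: vs => [|z u v' Pu fu _ IH]; first by rewrite add0r.
by rewrite -addrA; exact: eigen_sum_add Pu fu IH.
Qed.

Lemma eigen_sum1 P f z v : P v -> f v = z *: v -> eigen_sum P f v.
Proof.
move=> Pv fv; rewrite -[v]addr0.
exact: eigen_sum_add Pv fv (eigen_sum0 _ _).
Qed.

Lemma eigen_sum_map P Q f (g : {linear V -> V}) f' v (k : C) :
  (forall w, P w -> Q (g w)) ->
  (forall w z, P w -> f w = z *: w -> f' (g w) = (k * z) *: g w) ->
  eigen_sum P f v -> eigen_sum Q f' (g v).
Proof.
move=> PQ fg; elim=> [|z u v' Pu fu _ IH]; first by rewrite linear0; exact:
  eigen_sum0.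
by rewrite linearD; exact: eigen_sum_add (PQ _ Pu) (fg _ _ Pu fu) IH.
Qed.

Section Eigenspaces.
Variables (f : {linear V -> V}).

Lemma eigen_sum_uniq P v : eigen_sum P f v -> exists (s : seq C) (w : C -> V),
  [/\ uniq s, forall i, Defs.eigenspace f i (w i) & v = \sum_(i <- s) w i].
Proof.
elim=> [|z u v' _ fu _ [s [w [us ew ->]]]].
  exists [::], (fun=> 0); rewrite big_nil; split=> // i.
  by rewrite /Defs.eigenspace /= linear0 scaler0.
have [zs|zs] := boolP (z \in s).
  exists s, (fun i => if i == z then u + w i else w i); split=> // [i|].
    case: eqP => [->|_]; last exact: ew.
    by rewrite /Defs.eigenspace /= linearD fu (ew z) scalerDr.
  rewrite (bigD1_seq z) //= [RHS](bigD1_seq z) //= eqxx addrA; congr (_ + _).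
  by apply: eq_bigr => i /negPf ->.
exists (z :: s), (fun i => if i == z then u else w i); split=> [|i|].
- by rewrite /= zs.
- by case: eqP => [->|_]; [exact: fu | exact: ew].
rewrite big_cons eqxx; congr (_ + _); apply: eq_big_seq => i si.
by case: eqP si zs => // -> ->.
Qed.

(** Applying f - z removes the summand of eigenvalue z and rescales the others
    by nonzero factors. *)
Lemma eigenspaces_independent (s : seq C) (w : C -> V) :
  uniq s -> (forall i, Defs.eigenspace f i (w i)) -> \sum_(i <- s) w i = 0 ->
  forall i, i \in s -> w i = 0.
Proof.
elim: s w => // z s IH w /= /andP[zs us] ew; rewrite big_cons => sum0.
have ws i : i \in s -> w i = 0.
  move=> si; have iz : i - z != 0.
    by rewrite subr_eq0; apply: contraNneq zs => <-.
  apply/eqP; have /eqP : (i - z) *: w i = 0.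
    apply: (IH (fun i => (i - z) *: w i)) si => // [j|].
      by rewrite /Defs.eigenspace /= linearZ /= (ew j) !scalerA mulrC.
    have -> : \sum_(j <- s) (j - z) *: w j =
              f (w z + \sum_(j <- s) w j) - z *: (w z + \sum_(j <- s) w j).
      rewrite linearD (ew z) scalerDr opprD addrACA subrr add0r linear_sum.
      rewrite scaler_sumr -sumrB; apply: eq_bigr => j _.
      by rewrite (ew j) scalerBl.
    by rewrite sum0 linear0 scaler0 subrr.
  by rewrite scaler_eq0 (negPf iz).
move=> i; rewrite inE => /predU1P[->|/ws //].
by move: sum0; rewrite big_seq big1 ?addr0.
Qed.

Lemma diagonalisable_eigen_sum P :
  (forall v, eigen_sum P f v) -> diagonalisable f.
Proof.
move=> fP; split=> [i|v|s w us ew]; last exact: eigenspaces_independent.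
  split=> [|k v w]; rewrite /Defs.eigenspace /= ?linear0 ?scaler0 //.
  by rewrite linearP => -> ->; rewrite scalerDr !scalerA mulrC.
by have [s [w [us ew ->]]] := eigen_sum_uniq (fP v); exists s, w.
Qed.

(** If v is the sum of w_i with distinct eigenvalues i, then f (f v) = 0 says
    that every i^2 w_i vanishes. *)
Lemma eigen_sum_ker_sqr P v : eigen_sum P f v -> f (f v) = 0 -> f v = 0.
Proof.
case/eigen_sum_uniq => s [w [us ew ->]]; rewrite !linear_sum => ffv.
have f2 i : f (w i) = i *: w i by exact: ew.
have ew2 i : Defs.eigenspace f i (f (f (w i))).
  by rewrite /Defs.eigenspace /= !f2 !linearZ /= !f2 !linearZ /= f2.
rewrite big_seq big1 // => i si; have := eigenspaces_independent us ew2 ffv si.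
rewrite !f2 linearZ /= f2 scalerA => /eqP; rewrite scaler_eq0 mulf_eq0 orbb.
by case/orP => /eqP ->; rewrite ?scale0r ?scaler0.
Qed.

Lemma eigen_sum_ker_im P v : eigen_sum P f v ->
  exists u0 u1, f u0 = 0 /\ v = u0 + f u1.
Proof.
elim=> [|z u w _ fu _ [u0 [u1 [fu0 ->]]]].
  by exists 0, 0; rewrite linear0 addr0.
have [z0|z0] := eqVneq z 0.
  by exists (u + u0), u1; rewrite linearD fu z0 scale0r fu0 !add0r addrA.
exists u0, (z^-1 *: u + u1); rewrite linearD linearZ /= fu scalerA mulVf //.
by rewrite scale1r addrCA.
Qed.

End Eigenspaces.
End EigenvectorSums.

(** * The Hodge package of one differential *)
Lemma subspaceZ (C : numClosedFieldType) (V : lmodType C) (P : set V) k v :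
  subspace P -> P v -> P (k *: v).
Proof. by case=> P0 Pl Pv; rewrite -[_ *: _]addr0; apply: Pl. Qed.

Lemma subspaceB (C : numClosedFieldType) (V : lmodType C) (P : set V) v w :
  subspace P -> P v -> P w -> P (v - w).
Proof. by case=> _ Pl Pv Pw; rewrite addrC -scaleN1r; apply: Pl. Qed.

Section HodgeDecomposition.
Variables (C : numClosedFieldType) (V : lmodType C).

Lemma direct_sum3I (P Q T : set V) : subspace P -> subspace Q -> subspace T ->
  (forall v, exists p q t, [/\ P p, Q q, T t & v = p + q + t]) ->
  (forall p q t, P p -> Q q -> T t -> p + q + t = 0 ->
     [/\ p = 0, q = 0 & t = 0]) ->
  direct_sum3 P Q T.
Proof.
move=> sP sQ sT span indep.
have sub i : subspace (nth set0 [:: P; Q; T] (nat_of_ord (i : 'I_3))).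
  by case: i => [[|[|[|]]]].
split=> // [v|s w us Pw sum0 i si].
  have [p [q [t [Pp Qq Tt ->]]]] := span v.
  exists (enum 'I_3), (fun i : 'I_3 => nth 0 [:: p; q; t] (nat_of_ord i)).
  split; first exact: enum_uniq.
    by case=> [[|[|[|]]]].
  by rewrite big_enum /= 3!big_ord_recr big_ord0 /= add0r.
pose u j := if j \in s then w j else 0.
have Pu j : nth set0 [:: P; Q; T] (nat_of_ord j) (u j).
  by rewrite /u; case: ifP => // _; case: (sub j).
have sumu : \sum_(j < 3) u j = 0.
  by rewrite -[RHS]sum0 [RHS]big_uniq // [RHS]big_mkcond.
rewrite 3!big_ord_recr big_ord0 /= add0r in sumu.
have /= q0 := Pu (widen_ord (leqnSn 2) (widen_ord (leqnSn 1) ord_max)).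
have /= q1 := Pu (widen_ord (leqnSn 2) ord_max).
have [u0 u1 u2] := indep _ _ _ q0 q1 (Pu ord_max) sumu.
have -> : w i = u i by rewrite /u si.
case: i {si} => [[|[|[|//]]] i3]; [rewrite -[RHS]u0|rewrite -[RHS]u1|rewrite
  -[RHS]u2];
  by congr u; apply: val_inj.
Qed.

Definition hodge_theory (f g : V -> V) : Prop :=
  let D v := f v + g v in let DD v := D (D v) in
  [/\ diagonalisable D, diagonalisable DD, kernel DD = kernel D,
      kernel D = kernel f `&` kernel g
    & direct_sum3 (kernel DD) (range f) (range g)].

(** The operators d and ds are a differential and its codifferential, and N is
    their Laplacian up to the factor c.  The factor allows the same N to serve
    for d, del and delbar. *)
Section OneComplex.
Variables (d ds N : {linear V -> V}) (c : C).
Hypothesis c0 : c != 0.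
Hypothesis dd0 : forall v, d (d v) = 0.
Hypothesis dsds0 : forall v, ds (ds v) = 0.
Hypothesis laplN : forall v, d (ds v) + ds (d v) = c *: N v.
Hypothesis Nsum : forall v, eigen_sum setT N v.
Hypothesis kerN : forall v, N v = 0 -> d v = 0 /\ ds v = 0.

Let D : {linear V -> V} := d \+ ds.

Let DD v : D (D v) = c *: N v.
Proof. by rewrite /D /= !linearD /= dd0 dsds0 add0r addr0 laplN. Qed.

Let kerDD v : D (D v) = 0 -> N v = 0.
Proof. by rewrite DD => /eqP; rewrite scaler_eq0 (negPf c0) => /eqP. Qed.

(** On an eigenspace of D^2 for m^2 <> 0, the vectors m v + D v and m v - D v
    are eigenvectors of D for m and - m; on the kernel of D^2, D vanishes. *)
Lemma dirac_diagonalisable : diagonalisable D.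
Proof.
apply: (@diagonalisable_eigen_sum _ _ _ setT) => v.
elim: (Nsum v) => [|z {}v w _ Nv _ IH]; first exact: eigen_sum0.
apply: eigen_sumD IH.
have DDv : D (D v) = (c * z) *: v by rewrite DD Nv scalerA.
have [z0|z0] := eqVneq z 0.
  have [dv dsv] : d v = 0 /\ ds v = 0 by apply: kerN; rewrite Nv z0 scale0r.
  by apply: (@eigen_sum1 _ _ _ _ 0) => //; rewrite /D /= dv dsv scale0r addr0.
pose m := sqrtC (c * z); have m2 : m * m = c * z by rewrite -expr2 sqrtCK.
have m0 : m != 0 by rewrite sqrtC_eq0 mulf_neq0.
have -> : v = (2 * m)^-1 *: (m *: v + D v) + (2 * m)^-1 *: (m *: v - D v).
  rewrite -scalerDr addrACA subrr addr0 -scalerDl scalerA.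
  have -> : m + m = 2 * m by rewrite mulr_natl mulr2n.
  by rewrite mulVf ?scale1r // mulf_neq0 ?pnatr_eq0.
have DZ k u : D (k *: u) = k *: D u by rewrite linearZZ.
have DA u w' : D (u + w') = D u + D w' by rewrite linearD.
have DB u w' : D (u - w') = D u - D w' by rewrite linearB.
apply: eigen_sumD.
  apply: (@eigen_sum1 _ _ _ _ m) => //.
  rewrite DZ DA DZ DDv -m2 -scalerA -scalerDr addrC.
  by rewrite !scalerA mulrC.
apply: (@eigen_sum1 _ _ _ _ (- m)) => //.
rewrite DZ DB DZ DDv -m2 -scalerA -scalerBr.
by rewrite -[m *: v - _]opprB !scalerN scaleNr opprK !scalerA mulrC.
Qed.

Lemma laplacian_diagonalisable : diagonalisable (D \o D).
Proof.
apply: (@diagonalisable_eigen_sum _ _ _ setT) => v; rewrite -[v]/(idfun v).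
apply: (eigen_sum_map (f' := D \o D) (k := c)) (Nsum v) => // w z _ Nw.
by rewrite -scalerA -[z *: _]Nw -DD.
Qed.

Lemma ker_laplacian_dirac : kernel (D \o D) = kernel D.
Proof.
apply/seteqP; split=> v Dv.
  2: exact: etrans (congr1 D Dv) (linear0 D).
by have [dv dsv] := kerN (kerDD Dv); rewrite /kernel /D /= dv dsv addr0.
Qed.

Lemma ker_dirac : kernel D = kernel d `&` kernel ds.
Proof.
apply/seteqP; split=> v; last first.
  by case; rewrite /kernel /D /= => -> ->; rewrite addr0.
by move=> Dv; apply/kerN/kerDD/(etrans (congr1 D Dv) (linear0 D)).
Qed.

(** A vector is a harmonic one plus some N u, and N u is d of something plus ds
    of something.  For uniqueness, if h + d a + ds b = 0 then d ds b = 0, so ds b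
    is harmonic; but ds commutes with N, and an image under ds that is harmonic
    vanishes. *)
Lemma hodge_decomposition : direct_sum3 (kernel (D \o D)) (range d) (range ds).
Proof.
have subK : subspace (kernel (D \o D)).
  split=> [|k v w Dv Dw]; first exact: linear0.
  rewrite /kernel /= in Dv Dw *.
  by rewrite -[LHS]/((D \o D) _) linearP /= Dv Dw scaler0 addr0.
have subR (f : {linear V -> V}) : subspace (range f).
  split=> [|k _ _ [v _ <-] [w _ <-]]; first by exists 0; rewrite ?linear0.
  by exists (k *: v + w); rewrite ?linearP.
apply: direct_sum3I => // [v|h _ _ Dh [a _ <-] [b _ <-] sum0].
  have [h [u [Nh ->]]] := eigen_sum_ker_im (Nsum v).
  exists h, (d (c^-1 *: ds u)), (ds (c^-1 *: d u)); split; try by eexists.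
    by apply: etrans (DD h) _; rewrite Nh scaler0.
  rewrite -addrA; congr (_ + _).
  by rewrite !linearZ -scalerDr laplN scalerA mulVf ?scale1r.
have [dh dsh] := kerN (kerDD Dh).
have Nd v : N (d v) = d (N v).
  apply: (scalerI c0); rewrite -[RHS]linearZZ -!laplN dd0 linear0 addr0 linearD.
  by rewrite dd0 add0r.
have Nds v : N (ds v) = ds (N v).
  apply: (scalerI c0); rewrite -[RHS]linearZZ -!laplN dsds0 linear0 add0r linearD.
  by rewrite dsds0 addr0.
(* Up to ker N, which f kills, v is some N u, so f v = N (f u); the kernels of *)
(* N and N^2 agree.                                                            *)
have harm (f : {linear V -> V}) v : (forall v, N (f v) = f (N v)) ->
    (forall v, N v = 0 -> f v = 0) -> N (f v) = 0 -> f v = 0.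
  move=> Nf kerf; have [u0 [u1 [Nu0 ->]]] := eigen_sum_ker_im (Nsum v).
  rewrite linearD kerf // add0r -Nf => NNfu.
  exact: eigen_sum_ker_sqr (Nsum _) NNfu.
have da : d a = 0.
  apply: (harm d) => // [v /kerN[]//|]; apply: (scalerI c0).
  rewrite -laplN dd0 linear0 addr0 scaler0.
  have := congr1 ds sum0; rewrite !linearD dsh dsds0 linear0 add0r addr0 => ->.
  by rewrite linear0.
have dsb : ds b = 0.
  apply: (harm ds) => // [v /kerN[]//|]; apply: (scalerI c0).
  rewrite -laplN dsds0 linear0 add0r scaler0.
  have := congr1 d sum0; rewrite !linearD dh dd0 linear0 !add0r => ->.
  by rewrite linear0.
by move: sum0; rewrite da dsb !addr0.
Qed.

Lemma hodge_theory_of_spectrum : hodge_theory d ds.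
Proof.
split; [exact: dirac_diagonalisable | exact: laplacian_diagonalisable | | |].
- exact: ker_laplacian_dirac.
- exact: ker_dirac.
- exact: hodge_decomposition.
Qed.

End OneComplex.
End HodgeDecomposition.

(** * The Kaehler identities of a curve *)

(** The sets V00, V10, V01 and V11 are the forms of each bidegree of a complex of
    length two, and h is the Hodge map.  The last four hypotheses are what has
    to be known about functions: the spectrum and the kernel of the Laplacian,
    and exactness of one-forms. *)
Section KaehlerIdentities.
Variables (C : numClosedFieldType) (V : lmodType C).
Variables (d del delbar h : {linear V -> V}).
Variables (V00 V10 V01 V11 : set V).
Hypothesis span : forall v, exists v0 v1 v1' v2,
  [/\ V00 v0, V10 v1, V01 v1' & V11 v2] /\ v = v0 + v1 + v1' + v2.
Hypothesis indep : forall v0 v1 v1' v2, V00 v0 -> V10 v1 -> V01 v1' -> V11 v2 ->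
  v0 + v1 + v1' + v2 = 0 -> [/\ v0 = 0, v1 = 0, v1' = 0 & v2 = 0].
Hypothesis subP :
  [/\ subspace V00, subspace V10, subspace V01 & subspace V11].
Hypothesis dE : forall v, d v = del v + delbar v.
Hypothesis del_00 : forall v, V00 v -> V10 (del v).
Hypothesis delbar_00 : forall v, V00 v -> V01 (delbar v).
Hypothesis del_10 : forall v, V10 v -> del v = 0.
Hypothesis delbar_10 : forall v, V10 v -> V11 (delbar v).
Hypothesis del_01 : forall v, V01 v -> V11 (del v).
Hypothesis delbar_01 : forall v, V01 v -> delbar v = 0.
Hypothesis del_11 : forall v, V11 v -> del v = 0.
Hypothesis delbar_11 : forall v, V11 v -> delbar v = 0.
Hypothesis del_delbar_00 : forall v, V00 v -> del (delbar v) = - delbar (del v).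
Hypothesis h_00 : forall v, V00 v -> V11 (h v).
Hypothesis h_11 : forall v, V11 v -> V00 (h v).
Hypothesis hh_00 : forall v, V00 v -> h (h v) = v.
Hypothesis hh_11 : forall v, V11 v -> h (h v) = v.
Hypothesis h_10 : forall v, V10 v -> h v = 'i *: v.
Hypothesis h_01 : forall v, V01 v -> h v = - 'i *: v.
Hypothesis eigen_00 : forall v, V00 v ->
  eigen_sum V00 (fun w => - 'i *: h (delbar (del w))) v.
Hypothesis ker_00 : forall v, V00 v -> h (delbar (del v)) = 0 -> del v = 0 /\
  delbar v = 0.
Hypothesis exact_10 : forall v, V10 v -> exists2 w, V00 w & v = del w.
Hypothesis exact_01 : forall v, V01 v -> exists2 w, V00 w & v = delbar w.

(** The codifferential of d is the conjugate of d, but those of del and delbar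
    are the conjugates of delbar and del. *)
Definition hodge_conj (f : V -> V) (v : V) : V := - h (f (h v)).

Fact hodge_conj_linear (f : {linear V -> V}) : linear (hodge_conj f).
Proof. by move=> k v w; rewrite /hodge_conj !linearP. Qed.

HB.instance Definition _ (f : {linear V -> V}) :=
  GRing.isLinear.Build C V V *:%R (hodge_conj f) (hodge_conj_linear f).

Local Notation ds := (hodge_conj d).
Local Notation dels := (hodge_conj delbar).
Local Notation delbars := (hodge_conj del).

Lemma dsE v : ds v = dels v + delbars v.
Proof. by rewrite /hodge_conj dE (linearD h) opprD addrC. Qed.

Lemma linear_eq4 (f g : {linear V -> V}) :
  (forall v, V00 v -> f v = g v) -> (forall v, V10 v -> f v = g v) ->
  (forall v, V01 v -> f v = g v) -> (forall v, V11 v -> f v = g v) ->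
  forall v, f v = g v.
Proof.
move=> f0 f1 f1' f2 v; have [v0 [v1 [v1' [v2 [[p0 p1 p1' p2] ->]]]]] := span v.
by rewrite !linearD (f0 _ p0) (f1 _ p1) (f1' _ p1') (f2 _ p2).
Qed.

Lemma codiff_00 v : V00 v -> (dels v = 0) * (delbars v = 0).
Proof.
by move=> /h_00 p2; rewrite /hodge_conj del_11 // delbar_11 // !(linear0 h) oppr0.
Qed.

Lemma codiff_10 v : V10 v -> (dels v = - 'i *: h (delbar v)) * (delbars v = 0).
Proof.
move=> p1; rewrite /hodge_conj (h_10 p1) (linearZZ del) (linearZZ delbar) (del_10 p1).
by rewrite scaler0 (linear0 h) oppr0 (linearZZ h) scaleNr.
Qed.

Lemma codiff_01 v : V01 v -> (dels v = 0) * (delbars v = 'i *: h (del v)).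
Proof.
move=> p1; rewrite /hodge_conj (h_01 p1) (linearZZ del) (linearZZ delbar)
  (delbar_01 p1).
by rewrite scaler0 (linear0 h) oppr0 (linearZZ h) scaleNr opprK.
Qed.

Lemma codiff_11 v : V11 v -> (dels v = 'i *: delbar (h v)) * (delbars v = - 'i *:
  del (h v)).
Proof.
move=> /h_11 p0; rewrite /hodge_conj (h_01 (delbar_00 p0)) (h_10 (del_00 p0)).
by rewrite !scaleNr opprK.
Qed.

Let Lap : {linear V -> V} := (del \o dels) \+ (dels \o del).

Lemma Lap_00 v : V00 v -> Lap v = - 'i *: h (delbar (del v)).
Proof.
move=> p0; rewrite -[Lap v]/(del (dels v) + dels (del v)) codiff_00 // linear0 add0r.
by rewrite codiff_10; auto.
Qed.

Lemma Lap_10 v : V10 v -> Lap v = - 'i *: del (h (delbar v)).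
Proof.
move=> p1; rewrite -[Lap v]/(del (dels v) + dels (del v)) (codiff_10 p1) (del_10 p1).
by rewrite (linear0 dels) addr0 linearZZ.
Qed.

Lemma Lap_01 v : V01 v -> Lap v = 'i *: delbar (h (del v)).
Proof.
move=> p1; rewrite -[Lap v]/(del (dels v) + dels (del v)) (codiff_01 p1) linear0
  add0r.
by rewrite codiff_11; auto.
Qed.

Lemma Lap_11 v : V11 v -> Lap v = 'i *: del (delbar (h v)).
Proof.
move=> p2; rewrite -[Lap v]/(del (dels v) + dels (del v)) (codiff_11 p2) (del_11 p2).
by rewrite (linear0 dels) addr0 linearZZ.
Qed.

Lemma laplacian_del v : del (dels v) + dels (del v) = 1 *: Lap v.
Proof. by rewrite scale1r. Qed.

Lemma laplacian_delbar v : delbar (delbars v) + delbars (delbar v) = 1 *: Lap v.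
Proof.
rewrite scale1r -[LHS]/(((delbar \o delbars) \+ (delbars \o delbar)) v); move: v.
apply: linear_eq4 => v pv; rewrite -[LHS]/(delbar (delbars v) + delbars (delbar v)).
- rewrite codiff_00 // linear0 add0r codiff_01; last exact: delbar_00.
  by rewrite Lap_00 // del_delbar_00 // linearN scalerN scaleNr.
- rewrite codiff_10 // linear0 add0r codiff_11; last exact: delbar_10.
  by rewrite Lap_10.
- rewrite (codiff_01 pv) (delbar_01 pv) (linear0 delbars) addr0 linearZZ.
  by rewrite Lap_01.
- rewrite (codiff_11 pv) (delbar_11 pv) (linear0 delbars) addr0 linearZZ Lap_11
    // del_delbar_00; last exact: h_11.
  by rewrite scaleNr scalerN.
Qed.

(** The mixed terms of the d-Laplacian cancel in each bidegree, because h is 'i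
    on V10 and - 'i on V01. *)
Lemma laplacian_cross v :
  del (delbars v) + delbars (del v) + (delbar (dels v) + dels (delbar v)) = 0.
Proof.
rewrite -[LHS]/((((del \o delbars) \+ (delbars \o del)) \+ ((delbar \o dels) \+
  (dels \o delbar))) v).
rewrite -[RHS]/((\0%R : {linear V -> V}) v); move: v.
apply: linear_eq4 => v pv;
  rewrite -[LHS]/(del (delbars v) + delbars (del v) + (delbar (dels v) + dels
    (delbar v))) -[RHS]/0.
- rewrite !(codiff_00 pv) (codiff_10 (del_00 pv)) (codiff_01 (delbar_00 pv)).
  by rewrite (linear0 del) (linear0 delbar) !addr0.
- rewrite !(codiff_10 pv) (del_10 pv) (codiff_11 (delbar_10 pv)) (linear0 del).
  by rewrite (linear0 delbars) !add0r linearZZ -scalerDl addNr scale0r.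
- rewrite !(codiff_01 pv) (delbar_01 pv) (codiff_11 (del_01 pv)) (linear0 delbar).
  by rewrite (linear0 dels) !addr0 linearZZ -scalerDl addrN scale0r.
- rewrite !(codiff_11 pv) (del_11 pv) (delbar_11 pv) (linear0 dels) (linear0 delbars).
  rewrite !linearZZ (del_10 (del_00 (h_11 pv))) (delbar_01 (delbar_00 (h_11 pv))).
  by rewrite !scaler0 !addr0.
Qed.

Lemma laplacian_d v : d (ds v) + ds (d v) = 2 *: Lap v.
Proof.
move: (laplacian_del v) (laplacian_delbar v); move: (Lap v) => n Dn Dn'.
rewrite !dE !dsE !linearD.
rewrite [LHS](AC ((2*2)*(2*2)) ((1*5)*(4*8)*((2*7)*(3*6)))) /=.
by rewrite laplacian_cross Dn Dn' addr0 -scalerDl -mulr2n.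
Qed.

Lemma del_del v : del (del v) = 0.
Proof.
rewrite -[LHS]/((del \o del) v) -[RHS]/((\0%R : {linear V -> V}) v); move: v.
apply: linear_eq4 => v pv; rewrite -[LHS]/(del (del v)) -[RHS]/0.
- by rewrite del_10 //; exact: del_00.
- by rewrite (del_10 pv) linear0.
- by rewrite del_11 //; exact: del_01.
- by rewrite (del_11 pv) linear0.
Qed.

Lemma delbar_delbar v : delbar (delbar v) = 0.
Proof.
rewrite -[LHS]/((delbar \o delbar) v) -[RHS]/((\0%R : {linear V -> V}) v); move: v.
apply: linear_eq4 => v pv; rewrite -[LHS]/(delbar (delbar v)) -[RHS]/0.
- by rewrite delbar_01 //; exact: delbar_00.
- by rewrite delbar_11 //; exact: delbar_10.
- by rewrite (delbar_01 pv) linear0.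
- by rewrite (delbar_11 pv) linear0.
Qed.

Lemma del_delbar v : del (delbar v) + delbar (del v) = 0.
Proof.
rewrite -[LHS]/(((del \o delbar) \+ (delbar \o del)) v).
rewrite -[RHS]/((\0%R : {linear V -> V}) v); move: v.
apply: linear_eq4 => v pv; rewrite -[LHS]/(del (delbar v) + delbar (del v)) -[RHS]/0.
- by rewrite del_delbar_00 // addNr.
- by rewrite (del_10 pv) (del_11 (delbar_10 pv)) linear0 addr0.
- by rewrite (delbar_01 pv) (delbar_11 (del_01 pv)) linear0 addr0.
- by rewrite (del_11 pv) (delbar_11 pv) !linear0 addr0.
Qed.

Lemma dd v : d (d v) = 0.
Proof. by rewrite !dE !linearD del_del delbar_delbar add0r addr0 del_delbar. Qed.

Lemma dels_dels v : dels (dels v) = 0.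
Proof.
rewrite -[LHS]/((dels \o dels) v) -[RHS]/((\0%R : {linear V -> V}) v); move: v.
apply: linear_eq4 => v pv; rewrite -[LHS]/(dels (dels v)) -[RHS]/0.
- by rewrite (codiff_00 pv) linear0.
- by rewrite (codiff_10 pv) (linearZZ dels) /= (codiff_00 (h_11 (delbar_10 pv)))
    scaler0.
- by rewrite (codiff_01 pv) linear0.
- by rewrite (codiff_11 pv) (linearZZ dels) /= (codiff_01 (delbar_00 (h_11 pv)))
    scaler0.
Qed.

Lemma delbars_delbars v : delbars (delbars v) = 0.
Proof.
rewrite -[LHS]/((delbars \o delbars) v) -[RHS]/((\0%R : {linear V -> V}) v); move: v.
apply: linear_eq4 => v pv; rewrite -[LHS]/(delbars (delbars v)) -[RHS]/0.
- by rewrite (codiff_00 pv) linear0.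
- by rewrite (codiff_10 pv) linear0.
- by rewrite (codiff_01 pv) (linearZZ delbars) /= (codiff_00 (h_11 (del_01 pv)))
    scaler0.
- by rewrite (codiff_11 pv) (linearZZ delbars) /= (codiff_10 (del_00 (h_11 pv)))
    scaler0.
Qed.

Lemma dels_delbars v : dels (delbars v) + delbars (dels v) = 0.
Proof.
rewrite -[LHS]/(((dels \o delbars) \+ (delbars \o dels)) v).
rewrite -[RHS]/((\0%R : {linear V -> V}) v); move: v.
apply: linear_eq4 => v pv; rewrite -[LHS]/(dels (delbars v) + delbars (dels v))
  -[RHS]/0.
- by rewrite !(codiff_00 pv) !linear0 addr0.
- rewrite !(codiff_10 pv) linear0 (linearZZ delbars) /= (codiff_00 (h_11
    (delbar_10 pv))).
  by rewrite scaler0 addr0.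
- rewrite !(codiff_01 pv) linear0 (linearZZ dels) /= (codiff_00 (h_11 (del_01 pv))).
  by rewrite scaler0 addr0.
- have p0 := h_11 pv; rewrite !(codiff_11 pv) (linearZZ dels) (linearZZ delbars) /=.
  rewrite (codiff_10 (del_00 p0)) (codiff_01 (delbar_00 p0)) del_delbar_00 //
    linearN !scalerA.
  by rewrite mulrNN scalerN addrN.
Qed.

Lemma dsds v : ds (ds v) = 0.
Proof. by rewrite !dsE !linearD /= dels_dels delbars_delbars add0r addr0
  dels_delbars. Qed.

Lemma Lap_del v : V00 v -> Lap (del v) = del (Lap v).
Proof. by move=> p0; rewrite Lap_10 ?Lap_00 ?linearZZ; auto. Qed.

Lemma Lap_delbar v : V00 v -> Lap (delbar v) = delbar (Lap v).
Proof.
by move=> p0; rewrite Lap_01 ?Lap_00 ?linearZZ ?del_delbar_00 ?linearN ?scaleNr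
  ?scalerN; auto.
Qed.

Lemma Lap_h v : V00 v -> Lap (h v) = h (Lap v).
Proof.
move=> p0; rewrite (Lap_11 (h_00 p0)) (Lap_00 p0) (hh_00 p0) (linearZZ h).
by rewrite (hh_11 (delbar_10 (del_00 p0))) del_delbar_00 // scaleNr scalerN.
Qed.

Lemma eigen_sum_00 v : V00 v -> eigen_sum V00 Lap v.
Proof.
move=> p0; rewrite -[v]/(idfun v).
apply: (eigen_sum_map (k := 1)) (eigen_00 p0) => // w z pw Nw.
by rewrite mul1r -[LHS]/(Lap w) Lap_00 // Nw.
Qed.

(** Every bidegree is the image of V00 under a map commuting with Lap. *)
Lemma eigen_sum_all v : eigen_sum setT Lap v.
Proof.
have push (g : {linear V -> V}) w : V00 w ->
    (forall w, V00 w -> Lap (g w) = g (Lap w)) -> eigen_sum setT Lap (g w).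
  move=> pw Ng; apply: (eigen_sum_map (k := 1)) (eigen_sum_00 pw) => // u z pu Nu.
  by rewrite Ng // Nu linearZZ mul1r.
have [v0 [v1 [v1' [v2 [[p0 p1 p1' p2] ->]]]]] := span v.
have [w1 pw1 ->] := exact_10 p1; have [w1' pw1' ->] := exact_01 p1'.
apply: eigen_sumD; last by rewrite -(hh_11 p2); apply: push => [|w /Lap_h]; auto.
apply: eigen_sumD; last exact: push pw1' Lap_delbar.
apply: eigen_sumD; last exact: push pw1 Lap_del.
by apply: (push idfun).
Qed.

(** Harmonic one-forms vanish: if Lap (del w) = 0 then Lap (Lap w) = 0, so
    Lap w = 0 and del w = 0. *)
Lemma Lap_ker v : Lap v = 0 -> (del v = 0 /\ delbar v = 0) /\ (dels v = 0 /\
  delbars v = 0).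
Proof.
have [v0 [v1 [v1' [v2 [[p0 p1 p1' p2] ->]]]]] := span v.
have kerP w : V00 w -> Lap w = 0 -> del w = 0 /\ delbar w = 0.
  move=> pw; rewrite Lap_00 // => /eqP; rewrite scaler_eq0 oppr_eq0 (negPf
    (neq0Ci _)).
  by move/eqP/ker_00; apply.
have NN0 w : Lap (Lap w) = 0 -> Lap w = 0.
  exact: eigen_sum_ker_sqr (eigen_sum_all w).
have [s0 s1 s1' s2] := subP.
have q0 : V00 (Lap v0) by rewrite (Lap_00 p0); apply: subspaceZ => //; auto.
have q1 : V10 (Lap v1) by rewrite (Lap_10 p1); apply: subspaceZ => //; auto.
have q1' : V01 (Lap v1') by rewrite (Lap_01 p1'); apply: subspaceZ => //; auto.
have q2 : V11 (Lap v2) by rewrite (Lap_11 p2); apply: subspaceZ => //; auto 6.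
rewrite 3!(linearD Lap) => /(indep q0 q1 q1' q2)[Nv0 Nv1 Nv1' Nv2].
have v1_0 : v1 = 0.
  have [w pw v1E] := exact_10 p1; rewrite v1E.
  apply: (proj1 (kerP _ pw _)); apply: NN0.
  have Nw0 : V00 (Lap w) by rewrite (Lap_00 pw); apply: subspaceZ => //; auto.
  by rewrite (Lap_00 Nw0) -Lap_del // -v1E Nv1 !linear0.
have v1'_0 : v1' = 0.
  have [w pw v1'E] := exact_01 p1'; rewrite v1'E.
  apply: (proj2 (kerP _ pw _)); apply: NN0.
  have Nw0 : V00 (Lap w) by rewrite (Lap_00 pw); apply: subspaceZ => //; auto.
  have D21 : delbar (del (Lap w)) = 0.
    by apply: oppr_inj; rewrite -del_delbar_00 // -Lap_delbar // -v1'E Nv1' oppr0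
      linear0.
  by rewrite (Lap_00 Nw0) D21 !linear0.
rewrite v1_0 v1'_0 !addr0.
have [D1v0 D2v0] := kerP _ p0 Nv0.
have [D1hv2 D2hv2] : del (h v2) = 0 /\ delbar (h v2) = 0.
  apply: kerP; first exact: h_11.
  have hp2 := h_11 p2; have Nhp2 : V00 (Lap (h v2)).
    by rewrite (Lap_00 hp2); apply: subspaceZ => //; auto.
  by rewrite -(hh_00 Nhp2) -Lap_h // hh_11 // Nv2 linear0.
split; first by rewrite !linearD D1v0 D2v0 (del_11 p2) (delbar_11 p2) addr0.
rewrite !(linearD dels) !(linearD delbars) /= !(codiff_00 p0) !(codiff_11 p2).
by rewrite D1hv2 D2hv2 !scaler0 addr0.
Qed.

Theorem kaehler_hodge_theory :
  [/\ hodge_theory d ds, hodge_theory del dels & hodge_theory delbar delbars].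
Proof.
split.
- apply: (hodge_theory_of_spectrum (c := 2)) dd dsds laplacian_d eigen_sum_all _.
    by rewrite pnatr_eq0.
  by move=> v /Lap_ker[[D1v D2v] [D1sv D2sv]]; rewrite /= dE dsE D1v D2v D1sv
    D2sv addr0.
- apply: (hodge_theory_of_spectrum (oner_neq0 C)) del_del dels_dels laplacian_del _ _.
    exact: eigen_sum_all.
  by move=> v /Lap_ker[[? _] []].
- apply: (hodge_theory_of_spectrum (oner_neq0 C)) delbar_delbar delbars_delbars _
    eigen_sum_all _.
    exact: laplacian_delbar.
  by move=> v /Lap_ker[[_ ?] []].
Qed.

End KaehlerIdentities.

(** * Strings of a deformed sl_2 *)
Section Strings.
Variables (C : numClosedFieldType) (V : lmodType C) (W : int -> set V).
Variables (E F : {linear V -> V}) (p : C) (th : int -> C).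
Hypothesis subW : forall k, subspace (W k).
Hypothesis EW : forall k v, W k v -> W (k + 2) (E v).
Hypothesis FW : forall k v, W k v -> W (k - 2) (F v).
Hypothesis EF_FE : forall k v, W k v -> p *: E (F v) - F (E v) = th k *: v.
Hypothesis p_gt0 : 0 < p.
Hypothesis th_gt0 : forall k, 0 < k -> 0 < th k.

(** The number by which FE acts on a vector v of degree k with E^(n+1) v = 0, up
    to vectors killed by E^n. *)
Definition string_eigenvalue (k : int) (n : nat) : C :=
  \sum_(j < n) p ^- j.+1 * th (k + 2 * j.+1%:Z).

Local Notation c := string_eigenvalue.

Lemma string_eigenvalueS k n :
  c k n.+1 = c k n + p ^- n.+1 * th (k + 2 * n.+1%:Z).
Proof. exact: big_ord_recr. Qed.

Lemma string_eigenvalue_lt k m n : 0 <= k -> (m < n)%N -> c k m < c k n.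
Proof.
move=> k0; elim: n => // n IH; rewrite ltnS leq_eqVlt.
have step : c k n < c k n.+1.
  rewrite string_eigenvalueS ltrDl mulr_gt0 ?invr_gt0 ?exprn_gt0 ?th_gt0 //.
  by rewrite ltr_wpDl // mulr_gt0.
by case/predU1P => [->//|/IH /lt_trans]; apply.
Qed.

Lemma string_eigenvalue_ge0 k n : 0 <= k -> 0 <= c k n.
Proof.
move=> k0; have c0 : c k 0 = 0 by rewrite /c big_ord0.
by case: n => [|n]; rewrite -c0 // ltW // string_eigenvalue_lt.
Qed.

Lemma iterE_weight k v n : W k v -> W (k + 2 * n%:Z) (iter n E v).
Proof.
move=> Wv; elim: n => [|n IH]; first by rewrite mulr0 addr0.
by rewrite intS mulrDr mulr1 [2 + _]addrC addrA; apply: EW.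
Qed.

Lemma iterE_add n u v : iter n E (u + v) = iter n E u + iter n E v.
Proof. by elim: n => //= n ->; rewrite linearD. Qed.

Lemma iterE_scale n k v : iter n E (k *: v) = k *: iter n E v.
Proof. by elim: n => //= n ->; rewrite linearZZ. Qed.

(** Each E moved past FE uses E F = p^-1 (F E + th) once, in the degree reached
    so far. *)
Lemma iterE_FE k v n : W k v ->
  iter n E (F (E v)) = p ^- n *: F (E (iter n E v)) + c k n *: iter n E v.
Proof.
move=> Wv; elim: n => [|n IH].
  by rewrite /c big_ord0 scale0r addr0 expr0 invr1 scale1r.
have /EF_FE := iterE_weight n.+1 Wv; rewrite iterS; set u := iter n E v => EFu.
rewrite [in LHS]/= IH linearD !linearZZ -/u.
have -> : E (F (E u)) = p^-1 *: (F (E (E u)) + th (k + 2 * n.+1%:Z) *: E u).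
  by rewrite -EFu addrC subrK scalerA mulVf ?scale1r ?gt_eqF.
rewrite string_eigenvalueS scalerDl [RHS]addrCA addrC; congr (_ + _).
by rewrite scalerDr scalerDr !scalerA -invfM -exprSr addrC.
Qed.

Lemma iterE_FE_sub k v n : W k v -> iter n.+1 E v = 0 ->
  iter n E (F (E v) - c k n *: v) = 0.
Proof.
move=> Wv Ev; rewrite iterE_add (iterE_FE n Wv) -scaleNr iterE_scale -iterS Ev
  linear0.
by rewrite scaler0 add0r -scalerDl subrr scale0r.
Qed.

Lemma FE_weight k v a : W k v -> W k (F (E v) - a *: v).
Proof.
move=> Wv; apply: subspaceB => //; last exact: subspaceZ.
by have := FW (EW Wv); rewrite addrK.
Qed.

(** The vector (FE - c_N) v has a shorter string, hence by induction is a sum of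
    eigenvectors for c_0, ..., c_(N-1).  Dividing them by c_n - c_N and removing
    the result from v leaves an eigenvector for c_N. *)
Lemma string_eigen_sum N v : W 0 v -> iter N E v = 0 ->
  eigen_sum (W 0) (F \o E) v.
Proof.
move=> W0v ENv.
suff [w ew ->] : exists2 w : nat -> V, (forall n, (n < N)%N ->
    W 0 (w n) /\ F (E (w n)) = c 0 n *: w n) & v = \sum_(n < N) w n.
  elim: {v W0v ENv} N w ew => [|N IH] w ew.
    by rewrite big_ord0; exact: eigen_sum0.
  rewrite big_ord_recr /=; apply: eigen_sumD.
    by apply: IH => n nN; apply: ew; exact: ltnW.
  have [Ww Fw] := ew N (ltnSn N).
  exact: (@eigen_sum1 _ _ _ (F \o E) _ _ Ww Fw).
elim: N v W0v ENv => [|N IH] v W0v ENv.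
  by exists (fun=> 0) => //; rewrite big_ord0.
have [w ew yE] := IH _ (FE_weight (c 0 N) W0v) (iterE_FE_sub W0v ENv).
have cN n : (n < N)%N -> c 0 n - c 0 N != 0.
  by move=> nN; rewrite subr_eq0 lt_eqF // string_eigenvalue_lt.
pose u n := (c 0 n - c 0 N)^-1 *: w n.
have eu n : (n < N)%N -> W 0 (u n) /\ F (E (u n)) = c 0 n *: u n.
  move=> /ew[Ww Fw]; split; first exact: subspaceZ.
  by rewrite /u (linearZZ E) (linearZZ F) Fw !scalerA mulrC.
exists (fun n => if (n < N)%N then u n else v - \sum_(n < N) u n); last first.
  rewrite big_ord_recr /= ltnn addrC.
  under [X in _ + X]eq_bigr do rewrite ltn_ord.
  by rewrite subrK.
move=> n; rewrite ltnS leq_eqVlt; case: ltnP => [nN _|_]; first exact: eu.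
rewrite orbF => /eqP->; split.
  apply: subspaceB => //.
  elim/big_ind: _ => [|x y|i _]; first by case: (subW 0).
    by move=> Wx Wy; rewrite -[x]scale1r; exact: (proj2 (subW 0)).
  by case: (eu i).
have FEv : F (E v) = \sum_(n < N) w n + c 0 N *: v by rewrite -yE subrK.
have wE : \sum_(n < N) w n =
    \sum_(n < N) F (E (u n)) - c 0 N *: \sum_(n < N) u n.
  rewrite scaler_sumr -sumrB; apply: eq_bigr => j _.
  have [_ ->] := eu j (ltn_ord j); rewrite -scalerBl scalerA mulfV ?scale1r //.
  exact: cN.
have -> : F (E (v - \sum_(n < N) u n)) = F (E v) - \sum_(n < N) F (E (u n)).
  by rewrite !linearB !linear_sum.
by rewrite FEv wE scalerBr -addrA addrC -!addrA [X in _ + X]addrA addNr add0r.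
Qed.

(** On W 2, p EF = FE + th 2 has the eigenvalues c_n + th 2, which are positive,
    so EF is invertible there. *)
Lemma E_surjective N v : W 2 v -> iter N E v = 0 -> exists2 u, W 0 u & v = E u.
Proof.
elim: N v => [|N IH] v W2v ENv.
  by exists 0; rewrite ?linear0 //; case: (subW 0).
have [u W0u yE] := IH _ (FE_weight (c 2 N) W2v) (iterE_FE_sub W2v ENv).
have cth : c 2 N + th 2 != 0.
  by rewrite gt_eqF // ltr_wpDl ?th_gt0 ?string_eigenvalue_ge0.
have W0Fv : W 0 (F v) by have := FW W2v.
exists ((c 2 N + th 2)^-1 *: (p *: F v - u)).
  by apply: subspaceZ => //; apply: subspaceB => //; apply: subspaceZ.
rewrite linearZZ linearB linearZZ -yE opprB addrCA addrC.
have -> : p *: E (F v) - F (E v) = th 2 *: v by exact: EF_FE.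
by rewrite addrC -scalerDl scalerA mulVf ?scale1r.
Qed.

(** If F v = 0 then FE v = - th 2 v, so the nonzero number c_N + th 2 kills
    E^N v. *)
Lemma F_injective N v : W 2 v -> iter N E v = 0 -> F v = 0 -> v = 0.
Proof.
move=> W2v + Fv0; elim: N => [//|N IH] ENv; apply: IH.
have := iterE_FE_sub W2v ENv.
have := EF_FE W2v; rewrite Fv0 !linear0 sub0r => FEv.
rewrite -[F (E v)]opprK FEv -opprD -scalerDl -scaleNr iterE_scale => /eqP.
rewrite scaler_eq0 oppr_eq0 => /predU1P[cth|/eqP //].
suff : th 2 + c 2 N != 0 by rewrite cth eqxx.
by rewrite gt_eqF // ltr_wpDr ?th_gt0 ?string_eigenvalue_ge0.
Qed.

End Strings.

(** * Skew derivations and the operators E and F *)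
Section SkewExtension.
Variables (C : numClosedFieldType) (A : algType C).

(** The square-zero extension of A by A, with the right action twisted by tau: an
    algebra map x |-> (x, D x) is the same as a linear map D with
    D (x y) = x D y + D x tau(y).  The parameter tau is kept in the type because
    the product depends on it. *)
Definition skew_ext_of (tau : {lrmorphism A -> A}) : Type := (A * A)%type.

Variable tau : {lrmorphism A -> A}.
Local Notation skew_ext := (skew_ext_of tau).
HB.instance Definition _ := GRing.Lmodule.copy skew_ext (A * A)%type.

Definition skew_one : skew_ext := (1, 0).
Definition skew_mul (x y : skew_ext) : skew_ext :=
  (x.1 * y.1, x.1 * y.2 + x.2 * tau y.1).

Fact skew_mulA : associative skew_mul.
Proof.
move=> x y z; congr pair; rewrite /= ?mulrA //.
by rewrite rmorphM mulrDr mulrDl !mulrA addrA.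
Qed.
Fact skew_mul1 : left_id skew_one skew_mul.
Proof. by case=> x u; rewrite /skew_mul /= !mul1r mul0r addr0. Qed.
Fact skew_mulr1 : right_id skew_one skew_mul.
Proof. by case=> x u; rewrite /skew_mul /= rmorph1 !mulr1 mulr0 add0r. Qed.
Fact skew_mulDl : left_distributive skew_mul +%R.
Proof.
move=> x y z; congr pair; rewrite /= ?mulrDl //.
by rewrite addrACA.
Qed.
Fact skew_mulDr : right_distributive skew_mul +%R.
Proof.
move=> x y z; congr pair; rewrite /= ?mulrDr // linearD mulrDr.
by rewrite addrACA.
Qed.
Fact skew_one_neq0 : skew_one != 0.
Proof. by apply/eqP => -[/eqP]; rewrite oner_eq0. Qed.

HB.instance Definition _ := GRing.Zmodule_isNzRing.Build skew_ext
  skew_mulA skew_mul1 skew_mulr1 skew_mulDl skew_mulDr skew_one_neq0.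

Fact skew_scaleAl (k : C) (x y : skew_ext) : k *: skew_mul x y = skew_mul (k *: x) y.
Proof.
congr pair => /=; first exact: scalerAl.
by rewrite scalerDr; congr (_ + _); exact: scalerAl.
Qed.
HB.instance Definition _ := GRing.Lmodule_isLalgebra.Build C skew_ext skew_scaleAl.

Fact skew_scaleAr (k : C) (x y : skew_ext) : k *: skew_mul x y = skew_mul x (k *: y).
Proof.
congr pair => /=; first exact: scalerAr.
by rewrite scalerDr linearZZ; congr (_ + _); exact: scalerAr.
Qed.
HB.instance Definition _ := GRing.Lalgebra_isAlgebra.Build C skew_ext skew_scaleAr.

Definition skew_fst (x : skew_ext) : A := x.1.
Definition skew_snd (x : skew_ext) : A := x.2.

Fact skew_fst_linear : linear skew_fst. Proof. by []. Qed.
Fact skew_snd_linear : linear skew_snd. Proof. by []. Qed.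
Fact skew_fst_monoid : monoid_morphism skew_fst. Proof. by []. Qed.
HB.instance Definition _ :=
  GRing.isLinear.Build C skew_ext A *:%R skew_fst skew_fst_linear.
HB.instance Definition _ :=
  GRing.isLinear.Build C skew_ext A *:%R skew_snd skew_snd_linear.
HB.instance Definition _ :=
  GRing.isMonoidMorphism.Build skew_ext A skew_fst skew_fst_monoid.

End SkewExtension.

Section QuantumGroupAlgebra.
Variables (C : numClosedFieldType) (q : C) (A : CqSU2 q).
Hypothesis q0 : q != 0.

Local Notation a := (qg_a A).
Local Notation b := (qg_b A).
Local Notation c := (qg_c A).
Local Notation d := (qg_d A).
Local Notation eps := (qg_eps A).
Local Notation E := (@degree_part C q A).

Lemma mulab : a * b = q *: (b * a). Proof. by case: (qg_relations A) => -[]. Qed.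
Lemma mulac : a * c = q *: (c * a). Proof. by case: (qg_relations A) => -[]. Qed.
Lemma mulbd : b * d = q *: (d * b). Proof. by case: (qg_relations A) => -[]. Qed.
Lemma mulcd : c * d = q *: (d * c). Proof. by case: (qg_relations A) => -[]. Qed.
Lemma mulbc : b * c = c * b. Proof. by case: (qg_relations A). Qed.
Lemma mulad : a * d = 1 + q *: (b * c).
Proof. by case: (qg_relations A) => _ _ _ <-; rewrite subrK. Qed.
Lemma mulda : d * a = 1 + q^-1 *: (b * c).
Proof.
have [_ _ + _] := qg_relations A.
rewrite mulad scalerBl => /(congr1 (fun x => 1 + q *: (b * c) - x)).
by rewrite subKr -addrA subKr.
Qed.

Lemma mulba : b * a = q^-1 *: (a * b).
Proof. by rewrite mulab scalerA mulVf ?scale1r. Qed.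
Lemma mulca : c * a = q^-1 *: (a * c).
Proof. by rewrite mulac scalerA mulVf ?scale1r. Qed.
Lemma muldb : d * b = q^-1 *: (b * d).
Proof. by rewrite mulbd scalerA mulVf ?scale1r. Qed.
Lemma muldc : d * c = q^-1 *: (c * d).
Proof. by rewrite mulcd scalerA mulVf ?scale1r. Qed.

(** The grading as a one-parameter group of automorphisms. *)
Lemma scaling_exists (z : C) : z != 0 -> exists f : {lrmorphism A -> A},
  [/\ f a = z^-1 *: a, f b = z *: b, f c = z^-1 *: c & f d = z *: d].
Proof.
move=> z0; suff /(@qg_generation _ _ A)[f [fE _]] :
  q_relations q (z^-1 *: a) (z *: b) (z^-1 *: c) (z *: d) by exists f.
have zz : z^-1 * z = 1 by rewrite mulVf.
have zz' : z * z^-1 = 1 by rewrite mulfV.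
split; first split; rewrite -!scalerAl -!scalerAr !scalerA ?zz ?zz' ?scale1r
  ?mulfK //.
- exact: mulab.
- by rewrite mulac scalerA mulrC ?mulrA.
- by rewrite mulbd scalerA mulrC ?mulrA.
- exact: mulcd.
- exact: mulbc.
- by case: (qg_relations A).
- by case: (qg_relations A).
Qed.

Definition scaling (z : C) : {lrmorphism A -> A} :=
  if pselect (z != 0) is left z0 then sval (cid (scaling_exists z0)) else idfun.

Lemma scaling_gen (z : C) : z != 0 ->
  [/\ scaling z a = z^-1 *: a, scaling z b = z *: b,
      scaling z c = z^-1 *: c & scaling z d = z *: d].
Proof. by rewrite /scaling; case: pselect => // z0 _; case: cid. Qed.

Lemma scaling_degree z k x : z != 0 -> E k x -> scaling z x = z ^ k *: x.
Proof.
move=> z0; have [za zb zc zd] := scaling_gen z0.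
elim=> {k x} [k|k w x y _ IHx _ IHy||k l x y _ IHx _ IHy||||].
- by rewrite linear0 scaler0.
- by rewrite linearP /= IHx IHy scalerDr !scalerA mulrC.
- by rewrite rmorph1 expr0z scale1r.
- by rewrite rmorphM /= IHx IHy -scalerAl -scalerAr scalerA expfzDr.
- by rewrite za.
- by rewrite zb.
- by rewrite zc.
- by rewrite zd.
Qed.

Lemma degree_subspace k : subspace (E k).
Proof. by split=> [|z x y]; [exact: degree_part0 | exact: degree_partD]. Qed.

Lemma degreeM k l m x y : E k x -> E l y -> (k + l = m) -> E m (x * y).
Proof. by move=> Ex Ey <-; apply: degree_partM. Qed.

Lemma degreeZ k z x : E k x -> E k (z *: x).
Proof. by move=> Ex; apply: subspaceZ => //; exact: degree_subspace. Qed.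

(** The relations in the skew extension extend a, b, c, d |-> a', b', c', d' to
    an algebra map; its first component is the identity by uniqueness. *)
Lemma skew_derivation (tau : {lrmorphism A -> A}) (a' b' c' d' : A) :
  q_relations q ((a, a') : skew_ext_of tau) (b, b') (c, c') (d, d') ->
  exists D : {linear A -> A}, (forall x y, D (x * y) = x * D y + D x * tau y) /\
    [/\ D a = a', D b = b', D c = c' & D d = d'].
Proof.
case/(@qg_generation _ _ A) => f [[fa fb fc fd] _].
have fK x : skew_fst (f x) = x.
  have [g [_ gE]] := @qg_generation _ _ A _ _ _ _ _ (qg_relations A).
  transitivity (g x); last exact: esym (gE idfun _ x).
  by apply: (gE (@skew_fst _ _ tau \o f)); rewrite /= fa fb fc fd.
exists (@skew_snd _ _ tau \o f); split=> [x y|] /=; last by rewrite fa fb fc fd.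
transitivity (skew_fst (f x) * skew_snd (f y) +
              skew_snd (f x) * tau (skew_fst (f y))).
  by rewrite rmorphM.
by rewrite !fK.
Qed.

Lemma raising_exists : exists D : {linear A -> A},
  (forall x y, D (x * y) = x * D y + D x * scaling q y) /\
  [/\ D a = b, D b = 0, D c = d & D d = 0].
Proof.
apply: skew_derivation; have [qa qb qc qd] := scaling_gen q0.
split; first split; congr pair;
  rewrite /= ?qa ?qb ?qc ?qd ?mulr0 ?mul0r ?add0r ?addr0 ?scaler0 //.
- exact: mulab.
- by rewrite -scalerAr.
- exact: mulac.
- rewrite -!scalerAr scalerDr scalerA mulfV // scale1r mulad mulda mulbc.
  by rewrite [RHS]addrCA addrA.
- exact: mulbd.
- exact: mulcd.
- by rewrite -scalerAr.
- exact: mulbc.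
- by rewrite mulbd -scalerAr.
- by case: (qg_relations A).
- by rewrite -scalerAr muldb scalerBl.
- by case: (qg_relations A).
- by rewrite -scalerAr subrr.
Qed.

Lemma lowering_exists : exists D : {linear A -> A},
  (forall x y, D (x * y) = x * D y + D x * scaling q y) /\
  [/\ D a = 0, D b = a, D c = 0 & D d = c].
Proof.
apply: skew_derivation; have [qa qb qc qd] := scaling_gen q0.
split; first split; congr pair;
  rewrite /= ?qa ?qb ?qc ?qd ?mulr0 ?mul0r ?add0r ?addr0 ?scaler0 //.
- exact: mulab.
- by rewrite -scalerAr scalerA mulfV ?scale1r.
- exact: mulac.
- exact: mulbd.
- rewrite -!scalerAr scalerDr mulad mulda !scalerDr !scalerA mulfV // scale1r.
  by rewrite mulbc addrCA addrA.
- exact: mulcd.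
- by rewrite -scalerAr scalerA mulfV ?scale1r.
- exact: mulbc.
- by rewrite -scalerAr mulca.
- by case: (qg_relations A).
- by rewrite -!scalerAr mulca !scalerBl !scalerA mulfV // scale1r.
- by case: (qg_relations A).
- by rewrite -scalerAr scalerA mulfV // scale1r subrr.
Qed.

(** The generators of U_q(sl_2), acting through the right leg of the coproduct. *)
Definition raising : {linear A -> A} := sval (cid raising_exists).
Definition lowering : {linear A -> A} := sval (cid lowering_exists).

Lemma raisingM x y : raising (x * y) = x * raising y + raising x * scaling q y.
Proof. by rewrite /raising; case: cid => D []. Qed.

Lemma raising_gen :
  [/\ raising a = b, raising b = 0, raising c = d & raising d = 0].
Proof. by rewrite /raising; case: cid => D []. Qed.

Lemma loweringM x y :
  lowering (x * y) = x * lowering y + lowering x * scaling q y.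
Proof. by rewrite /lowering; case: cid => D []. Qed.

Lemma lowering_gen :
  [/\ lowering a = 0, lowering b = a, lowering c = 0 & lowering d = c].
Proof. by rewrite /lowering; case: cid => D []. Qed.

Lemma raising1 : raising 1 = 0.
Proof.
have := raisingM 1 1; rewrite rmorph1 !mulr1 mul1r => /eqP.
by rewrite -subr_eq subrr => /eqP <-.
Qed.

Lemma lowering1 : lowering 1 = 0.
Proof.
have := loweringM 1 1; rewrite rmorph1 !mulr1 mul1r => /eqP.
by rewrite -subr_eq subrr => /eqP <-.
Qed.

Lemma degree_scaling k x : E k x -> scaling q x = q ^ k *: x.
Proof. exact: scaling_degree. Qed.

Lemma raising_degree k x : E k x -> E (k + 2) (raising x).
Proof.
have [ra rb rc rd] := raising_gen.
elim=> {k x} [k|k w x y _ IHx _ IHy||k l x y Ex IHx Ey IHy||||];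
  rewrite ?raising1 ?ra ?rb ?rc ?rd ?linear0; try exact: degree_part0.
- by rewrite linearP; exact: degree_partD.
- rewrite raisingM -[x * _]scale1r; apply: degree_partD.
    by apply: degreeM Ex IHy _; rewrite addrA.
  rewrite (degree_scaling Ey) -scalerAr; apply: degreeZ.
  by apply: degreeM IHx Ey _; rewrite addrAC.
- exact: degree_part_b.
- exact: degree_part_d.
Qed.

Lemma lowering_degree k x : E k x -> E (k - 2) (lowering x).
Proof.
have [ra rb rc rd] := lowering_gen.
elim=> {k x} [k|k w x y _ IHx _ IHy||k l x y Ex IHx Ey IHy||||];
  rewrite ?lowering1 ?ra ?rb ?rc ?rd ?linear0; try exact: degree_part0.
- by rewrite linearP; exact: degree_partD.
- rewrite loweringM -[x * _]scale1r; apply: degree_partD.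
    by apply: degreeM Ex IHy _; rewrite addrA.
  rewrite (degree_scaling Ey) -scalerAr; apply: degreeZ.
  by apply: degreeM IHx Ey _; rewrite addrAC.
- exact: degree_part_a.
- exact: degree_part_c.
Qed.

(** The sum of q^2, q^4, ..., q^(2k) for k >= 0, in closed form so as to make
    sense for all k; at q^2 = 1 the quotient is replaced by its limit. *)
Definition qweight (k : int) : C :=
  if q ^+ 2 == 1 then k%:~R else ((q ^+ 2) ^ k - 1) / (1 - q ^- 2).

Lemma qweightD k l : qweight (k + l) = qweight l + qweight k * (q ^+ 2) ^ l.
Proof.
rewrite /qweight; case: ifP => [/eqP->|_]; first by rewrite exp1rz mulr1 intrD addrC.
rewrite expfzDr ?expf_neq0 //; ring.
Qed.

Lemma qweight1 : qweight 1 = q ^+ 2.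
Proof.
rewrite /qweight; case: eqP => [->//|/eqP q1]; rewrite expr1z.
have q20 : q ^+ 2 != 0 by rewrite expf_neq0.
by field; rewrite q0 subr_eq0.
Qed.

Lemma qweight0 : qweight 0 = 0.
Proof. by rewrite /qweight expr0z subrr mul0r mulr0z if_same. Qed.

Lemma qweightN k : qweight (- k) = - (qweight k * (q ^+ 2) ^ (- k)).
Proof. by apply/eqP; rewrite -addr_eq0 -qweightD addrN qweight0. Qed.

(** Both sides are skew derivations for the square of scaling q, so it suffices
    to compare them on generators. *)
Lemma raising_lowering k x : E k x ->
  q ^+ 2 *: raising (lowering x) - lowering (raising x) = qweight k *: x.
Proof.
have [ra rb rc rd] := raising_gen; have [la lb lc ld] := lowering_gen.
have w1 : qweight (-1) = -1.
  by rewrite qweightN qweight1 exprN1 mulfV // expf_neq0.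
elim=> {k x} [k|k w x y _ IHx _ IHy||k l x y Ex IHx Ey IHy||||].
- by rewrite !linear0 addr0.
- rewrite (linearP lowering) (linearP raising w x) (linearP raising).
  rewrite (linearP lowering w (raising x)) scalerDr opprD addrACA IHy scalerDr.
  congr (_ + _); transitivity (w *: (qweight k *: x)).
    by rewrite -IHx scalerBr !scalerA [_ * w]mulrC.
  by rewrite !scalerA mulrC.
- by rewrite raising1 lowering1 !linear0 addr0 qweight0 scale0r.
- have tF : scaling q (lowering y) = q ^ (l - 2) *: lowering y.
    exact: degree_scaling (lowering_degree Ey).
  have tE : scaling q (raising y) = q ^ (l + 2) *: raising y.
    exact: degree_scaling (raising_degree Ey).
  have ty := degree_scaling Ey.
  have qm : q ^+ 2 * q ^ (l - 2) = q ^ l.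
    by rewrite -[q ^+ 2]/(q ^ 2%:Z) -expfzDr // addrC subrK.
  have qp : q ^ (l + 2) = q ^+ 2 * q ^ l by rewrite expfzDr // mulrC.
  have cancel (V : zmodType) (p u v r s w : V) :
      (p + u + v + r) - (s + v + u + w) = (p - s) + (r - w).
    rewrite !opprD [LHS](AC (4*4) ((1*5)*(4*8)*(2*7)*(3*6))) /=.
    by rewrite !subrr !addr0.
  have -> : raising (lowering (x * y)) =
      x * raising (lowering y) + q ^ (l - 2) *: (raising x * lowering y) +
      q ^ l *: (lowering x * raising y) +
      (q ^ l * q ^ l) *: (raising (lowering x) * y).
    rewrite loweringM ty -scalerAr linearD (linearZZ raising) !raisingM tF ty.
    by rewrite -!scalerAr scalerDr scalerA addrA.
  have -> : lowering (raising (x * y)) =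
      x * lowering (raising y) + (q ^+ 2 * q ^ l) *: (lowering x * raising y) +
      q ^ l *: (raising x * lowering y) +
      (q ^ l * q ^ l) *: (lowering (raising x) * y).
    rewrite raisingM ty -scalerAr linearD (linearZZ lowering) !loweringM tE ty.
    by rewrite -!scalerAr scalerDr scalerA addrA qp.
  rewrite !scalerDr !scalerA qm cancel [q ^+ 2 * (_ * _)]mulrC -(scalerA (q ^ l *
    q ^ l)).
  rewrite -scalerBr [q ^+ 2 *: (_ * y)]scalerAl -mulrBl IHx.
  rewrite [q ^+ 2 *: (x * _)]scalerAr -mulrBr IHy -scalerAr -scalerAl scalerA
    -scalerDl qweightD; congr (_ *: _).
  by rewrite -[q ^+ 2]/(q ^ 2%:Z) exprzAC [_ ^ 2]/(_ * _) mulrC.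
- by rewrite la ra lb linear0 scaler0 sub0r w1 scaleN1r.
- by rewrite lb rb ra linear0 subr0 qweight1.
- by rewrite lc rc ld linear0 scaler0 sub0r w1 scaleN1r.
- by rewrite ld rd rc linear0 subr0 qweight1.
Qed.

Section LocalNilpotency.
Variables (D : {linear A -> A}) (s : int).
Hypothesis DM : forall x y, D (x * y) = x * D y + D x * scaling q y.
Hypothesis Ddeg : forall k x, E k x -> E (k + s) (D x).

Let iter0 n : iter n D 0 = 0.
Proof. by elim: n => //= n ->; rewrite linear0. Qed.

Let iter_vanish m n x : (m <= n)%N -> iter m D x = 0 -> iter n D x = 0.
Proof. by move=> /subnK <- Dx; rewrite iterD Dx iter0. Qed.

Let iter_linear n z x y : iter n D (z *: x + y) = z *: iter n D x + iter n D y.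
Proof. by elim: n => //= n ->; rewrite linearP. Qed.

Let iter_mul m n k l x y : E k x -> E l y ->
  iter m D x = 0 -> iter n D y = 0 -> iter (m + n) D (x * y) = 0.
Proof.
move: {2}(m + n)%N (leqnn (m + n)) => N.
elim: N m n k l x y => [|N IH] m n k l x y mnN Ex Ey Dx Dy.
  by move: mnN Dx Dy; case: m => // /= _ ->; rewrite mul0r iter0.
case: m Dx mnN => [/= -> _|m Dx mnN]; first by rewrite mul0r iter0.
case: n Dy mnN => [/= -> _|n Dy mnN]; first by rewrite mulr0 iter0 linear0.
rewrite addnS iterSr DM (degree_scaling Ey) -scalerAr addrC iter_linear.
rewrite [X in _ + X](IH m.+1 n _ _ _ _ _ Ex (Ddeg Ey)) -?iterSr //; last first.
  by rewrite addSn -addnS.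
rewrite addSnnS (IH m n.+1 _ _ _ _ _ (Ddeg Ex) Ey) -?iterSr ?addr0 ?scaler0 //.
Qed.

(** By the twisted Leibniz rule, D^m x = 0 and D^n y = 0 imply D^(m+n) (x y) = 0. *)
Lemma skew_derivation_nilpotent :
  [/\ D (D a) = 0, D (D b) = 0, D (D c) = 0 & D (D d) = 0] ->
  forall k x, E k x -> exists N, iter N D x = 0.
Proof.
move=> [Da Db Dc Dd] k x; elim=> {k x}
  [k|k w x y _ [m Dx] _ [n Dy]||k l x y Ex [m Dx] Ey [n Dy]||||].
- by exists 0%N.
- exists (m + n)%N; rewrite iter_linear (iter_vanish (leq_addr n m) Dx).
  by rewrite (iter_vanish (leq_addl m n) Dy) scaler0 addr0.
- exists 1%N => /=; have := DM 1 1; rewrite rmorph1 !mulr1 mul1r => /eqP.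
  by rewrite -subr_eq subrr => /eqP <-.
- by exists (m + n)%N; apply: iter_mul Dx Dy; eassumption.
- by exists 2%N.
- by exists 2%N.
- by exists 2%N.
- by exists 2%N.
Qed.

End LocalNilpotency.

Lemma raising_nilpotent k x : E k x -> exists N, iter N raising x = 0.
Proof.
apply: (skew_derivation_nilpotent raisingM raising_degree).
by have [ra rb rc rd] := raising_gen; rewrite ra rc rb rd linear0.
Qed.

Lemma lowering_nilpotent k x : E k x -> exists N, iter N lowering x = 0.
Proof.
apply: (skew_derivation_nilpotent loweringM lowering_degree).
by have [la lb lc ld] := lowering_gen; rewrite lb ld la lc linear0.
Qed.

Lemma eps_gen : [/\ eps a = 1, eps b = 0, eps c = 0 & eps d = 1].
Proof. exact: qg_eps_gen. Qed.

(** The star of ab = q ba reads cd = conj(q) dc, to be compared with cd = q dc;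
    and dc is not 0, because raising it gives d^2. *)
Lemma q_real : q \is Num.real.
Proof.
have [_ ea0 _ ed] := eps_gen; have [_ _ rc rd] := raising_gen.
have [sa sd sb sc] := qg_star_gen A.
apply/CrealP; apply: contraTeq (oner_neq0 C) => qq.
have dc0 : d * c = 0.
  have star0 : @qg_star _ _ A 0 = 0.
    have := @qg_star_conj _ _ A 1 0 0.
    by rewrite !scaler0 add0r rmorph1 scale1r => /eqP; rewrite -subr_eq subrr =>
      /eqP <-.
  have := congr1 (@qg_star _ _ A) mulab.
  have -> : qg_star (q *: (b * a)) = Num.conj q *: qg_star (b * a) :> A.
    by have := @qg_star_conj _ _ A q (b * a) 0; rewrite star0 !addr0.
  rewrite !qg_starM sa sb -scalerAl -scalerAr mulcd !scalerA => /eqP.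
  rewrite -subr_eq0 -scalerBl scaler_eq0 => /predU1P[|/eqP //].
  have -> : - q * q - q^* * - q = (q^* - q) * q by ring.
  by move/eqP; rewrite mulf_eq0 (negPf q0) orbF subr_eq0 (negPf qq).
have := raisingM d c; rewrite dc0 linear0 rc rd mul0r addr0 => /(congr1 eps).
by rewrite linear0 rmorphM /= ed mulr1 negbK => /esym e; apply/eqP.
Qed.

Lemma q2_gt0 : 0 < q ^+ 2.
Proof. by rewrite real_exprn_even_gt0 ?q_real. Qed.

Lemma qweight_gt0 k : 0 < k -> 0 < qweight k.
Proof.
case: k => // -[//|n] _; elim: n => [|n IH].
  by rewrite qweight1 q2_gt0.
rewrite intS addrC qweightD qweight1 expr1z.
exact: addr_gt0 q2_gt0 (mulr_gt0 IH q2_gt0).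
Qed.

Let lowering_raising k x : E k x ->
  (q ^+ 2)^-1 *: lowering (raising x) - raising (lowering x) =
  (- ((q ^+ 2)^-1 * qweight k)) *: x.
Proof.
move=> Ex; rewrite scaleNr -scalerA -raising_lowering // scalerBr opprB.
by rewrite scalerA mulVf ?scale1r // expf_neq0.
Qed.

(** * Spectrum, surjectivity and kernels in degrees 0, 2 and -2 *)
Lemma degree0_eigen_sum x : E 0 x -> eigen_sum (E 0) (lowering \o raising) x.
Proof.
move=> Ex; have [N Nx] := raising_nilpotent Ex.
exact: (string_eigen_sum degree_subspace raising_degree lowering_degree
  raising_lowering q2_gt0 qweight_gt0 Ex Nx).
Qed.

Lemma raising_onto x : E 2 x -> exists2 y, E 0 y & x = raising y.
Proof.
move=> Ex; have [N Nx] := raising_nilpotent Ex.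
exact: (E_surjective degree_subspace raising_degree lowering_degree
  raising_lowering q2_gt0 qweight_gt0 Ex Nx).
Qed.

Lemma lowering_inj x : E 2 x -> lowering x = 0 -> x = 0.
Proof.
move=> Ex; have [N Nx] := raising_nilpotent Ex.
exact: (F_injective raising_degree raising_lowering q2_gt0 qweight_gt0 Ex Nx).
Qed.

(** Exchanging the two operators, reversing the grading and replacing q^2 by q^-2
    preserves the hypotheses of the string argument. *)
Let E' (k : int) : set A := E (- k).
Let qweight' k := - ((q ^+ 2)^-1 * qweight (- k)).

Let subE' k : subspace (E' k). Proof. exact: degree_subspace. Qed.
Let lowE' k x : E' k x -> E' (k + 2) (lowering x).
Proof. by rewrite /E' opprD; exact: lowering_degree. Qed.
Let raiE' k x : E' k x -> E' (k - 2) (raising x).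
Proof. by rewrite /E' opprB [2 - k]addrC; exact: raising_degree. Qed.
Let relE' k x : E' k x -> (q ^+ 2)^-1 *: lowering (raising x) -
  raising (lowering x) = qweight' k *: x.
Proof. exact: lowering_raising. Qed.
Let q2V_gt0 : 0 < (q ^+ 2)^-1. Proof. by rewrite invr_gt0 q2_gt0. Qed.
Let qweight'_gt0 k : 0 < k -> 0 < qweight' k.
Proof.
move=> k0; rewrite /qweight' qweightN mulrN opprK mulr_gt0 // mulr_gt0 //.
  exact: qweight_gt0.
by rewrite exprz_gt0 ?q2_gt0.
Qed.

Lemma lowering_onto x : E (-2) x -> exists2 y, E 0 y & x = lowering y.
Proof.
move=> Ex; have [N Nx] := lowering_nilpotent Ex.
have [y Ey ->] := E_surjective subE' lowE' raiE' relE' q2V_gt0 qweight'_gt0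
  (Ex : E' 2 x) Nx.
by exists y.
Qed.

Lemma raising_inj x : E (-2) x -> raising x = 0 -> x = 0.
Proof.
move=> Ex; have [N Nx] := lowering_nilpotent Ex.
exact: (F_injective lowE' relE' q2V_gt0 qweight'_gt0 (Ex : E' 2 x) Nx).
Qed.

Lemma raising_lowering0 x : E 0 x ->
  lowering (raising x) = q ^+ 2 *: raising (lowering x).
Proof.
by move=> /raising_lowering/eqP; rewrite qweight0 scale0r subr_eq0 => /eqP.
Qed.

Lemma lowering_raising_ker x : E 0 x -> lowering (raising x) = 0 ->
  raising x = 0 /\ lowering x = 0.
Proof.
move=> Ex FEx; split; first exact: lowering_inj (raising_degree Ex) FEx.
apply: raising_inj (lowering_degree Ex) _; move: FEx.
rewrite raising_lowering0 // => /eqP; rewrite scaler_eq0 expf_eq0 (negPf q0).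
by rewrite andbF => /eqP.
Qed.

(** * Generators of the Podles sphere *)

(** The subalgebra generated by b_-, b_0 and b_+, which turns out to be E_0; this
    gives an induction principle along which derivations can be compared. *)
Inductive sphere : A -> Prop :=
| sphere1 : sphere 1
| sphere_bm : sphere (a * b)
| sphere_b0 : sphere (b * c)
| sphere_bp : sphere (c * d)
| sphere_lin z x y : sphere x -> sphere y -> sphere (z *: x + y)
| sphereM x y : sphere x -> sphere y -> sphere (x * y).

Lemma sphere0 : sphere 0.
Proof. by have := sphere_lin (-1) sphere1 sphere1; rewrite scaleN1r addNr. Qed.
Lemma sphereZ z x : sphere x -> sphere (z *: x).
Proof. by move=> sx; rewrite -[_ *: x]addr0; exact: sphere_lin sx sphere0. Qed.
Lemma sphereD x y : sphere x -> sphere y -> sphere (x + y).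
Proof. by move=> sx sy; rewrite -[x]scale1r; exact: sphere_lin. Qed.

Definition row_span (g h : A) (P : A -> Prop) (x : A) : Prop :=
  exists u v, [/\ P u, P v & x = u * g + v * h].

(** The span of the products of an element of the sphere and n letters, each g
    or h. *)
Fixpoint sphere_words (g h : A) n : A -> Prop :=
  if n is m.+1 then row_span g h (sphere_words g h m) else sphere.

Lemma row_span_lin g h (P : A -> Prop) z x y :
  (forall u v, P u -> P v -> P (z *: u + v)) ->
  row_span g h P x -> row_span g h P y -> row_span g h P (z *: x + y).
Proof.
move=> Pl [u [v [Pu Pv ->]]] [u' [v' [Pu' Pv' ->]]].
exists (z *: u + u'), (z *: v + v'); split; try exact: Pl.
by rewrite !mulrDl scalerDr !scalerAl addrACA.
Qed.

Lemma sphere_words_lin g h n z x y : sphere_words g h n x ->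
  sphere_words g h n y -> sphere_words g h n (z *: x + y).
Proof.
elim: n x y => [|n IH] x y; first exact: sphere_lin.
by apply: row_span_lin => u v; exact: IH.
Qed.

Lemma sphere_words0 g h n : sphere_words g h n 0.
Proof.
elim: n => [|n IH]; first exact: sphere0.
by exists 0, 0; rewrite !mul0r addr0.
Qed.

(** Moving a letter past the sphere yields a combination of both letters; so
    sphere_words is a right module over the sphere. *)
Definition normalises (g h : A) := forall x, sphere x ->
  row_span g h sphere (g * x) /\ row_span g h sphere (h * x).

Lemma normalises_gens g h :
  (forall x, x \in [:: a * b; b * c; c * d] ->
    row_span g h sphere (g * x) /\ row_span g h sphere (h * x)) ->
  normalises g h.
Proof.
move=> gens x; elim=> {x} [||||z x y _ [gx hx] _ [gy hy]|x y sx [gx hx] sy [gy hy]].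
- split; rewrite mulr1; [exists 1, 0 | exists 0, 1].
    by rewrite mul1r mul0r addr0; split=> //; [exact: sphere1 | exact: sphere0].
  by rewrite mul1r mul0r add0r; split=> //; [exact: sphere0 | exact: sphere1].
- by apply: gens; rewrite !inE eqxx.
- by apply: gens; rewrite !inE eqxx orbT.
- by apply: gens; rewrite !inE eqxx !orbT.
- by split; rewrite mulrDr -scalerAr; apply: row_span_lin => // u v; exact:
    sphere_lin.
have step t : row_span g h sphere t -> row_span g h sphere (t * y).
  case=> u [v [su sv ->]]; rewrite mulrDl -!mulrA.
  have lm w t' : sphere w -> row_span g h sphere t' -> row_span g h sphere (w * t').
    move=> sw [u' [v' [su' sv' ->]]]; exists (w * u'), (w * v').
    by split; [exact: sphereM | exact: sphereM | rewrite mulrDr !mulrA].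
  rewrite -[u * _]scale1r; apply: row_span_lin; [exact: sphere_lin | exact: lm..].
by split; rewrite mulrA; exact: step.
Qed.

Lemma sphere_wordsM g h n x y : normalises g h ->
  sphere_words g h n x -> sphere y -> sphere_words g h n (x * y).
Proof.
move=> gh; elim: n x y => [|n IH] x y; first exact: sphereM.
case=> u [v [Pu Pv ->]] /gh[[u1 [v1 [su1 sv1 gy]]] [u2 [v2 [su2 sv2 hy]]]].
rewrite mulrDl -!mulrA gy hy !mulrDr !mulrA addrACA -!mulrDl.
have add s t : sphere_words g h n s -> sphere_words g h n t ->
    sphere_words g h n (s + t).
  by move=> Ps Pt; rewrite -[s]scale1r; exact: sphere_words_lin.
exists (u * u1 + v * u2), (u * v1 + v * v2).
by split=> //; apply: add; exact: IH.
Qed.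

Lemma row_spanl g h x : sphere x -> row_span g h sphere (x * g).
Proof. by exists x, 0; rewrite mul0r addr0; split=> //; exact: sphere0. Qed.

Lemma row_spanr g h x : sphere x -> row_span g h sphere (x * h).
Proof. by exists 0, x; rewrite mul0r add0r; split=> //; exact: sphere0. Qed.

Lemma sphere_ad : sphere (a * d).
Proof.
by rewrite mulad; apply: sphereD; [exact: sphere1 | apply/sphereZ/sphere_b0].
Qed.

Lemma sphere_da : sphere (d * a).
Proof.
by rewrite mulda; apply: sphereD; [exact: sphere1 | apply/sphereZ/sphere_b0].
Qed.

Lemma sphere_cb : sphere (c * b).
Proof. rewrite -mulbc; exact: sphere_b0. Qed.

Lemma sphere_ba : sphere (b * a).
Proof. rewrite mulba; apply/sphereZ/sphere_bm. Qed.

Lemma sphere_dc : sphere (d * c).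
Proof. rewrite muldc; apply/sphereZ/sphere_bp. Qed.

Lemma normalises_bd : normalises b d.
Proof.
apply: normalises_gens => x; rewrite !inE => /or3P[]/eqP->; rewrite !mulrA; split.
- by apply: row_spanl; exact: sphere_ba.
- by apply: row_spanl; exact: sphere_da.
- by rewrite -mulrA mulbc mulrA; apply: row_spanl; exact: sphere_b0.
- rewrite muldb -scalerAl -mulrA muldc -scalerAr scalerA mulrA scalerAl.
  by apply: row_spanr; apply/sphereZ/sphere_b0.
- by apply: row_spanr; exact: sphere_b0.
- by apply: row_spanr; exact: sphere_dc.
Qed.

Lemma normalises_ac : normalises a c.
Proof.
apply: normalises_gens => x; rewrite !inE => /or3P[]/eqP->; rewrite !mulrA; split.
- by rewrite -mulrA mulab -scalerAr mulrA scalerAl; apply/row_spanl/sphereZ/sphere_bm.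
- by rewrite mulca -scalerAl -mulrA -mulbc mulrA scalerAl;
    apply/row_spanr/sphereZ/sphere_bm.
- rewrite mulab -scalerAl -mulrA mulac -scalerAr scalerA mulrA scalerAl.
  by apply/row_spanl/sphereZ/sphere_b0.
- by apply/row_spanr/sphere_cb.
- rewrite mulac -scalerAl -mulrA mulad mulrDr mulr1 -scalerAr mulrA -[X in X +
    _]mul1r.
  rewrite scalerAl -mulrDl scalerAl.
  apply/row_spanr/sphereZ/sphereD; first exact: sphere1.
  exact/sphereZ/sphere_cb.
- by rewrite -mulrA mulcd -scalerAr mulrA scalerAl; apply/row_spanr/sphereZ/sphere_bp.
Qed.

(** The degree k part, as a left module over the sphere: k letters b, d if
    k >= 0, and - k letters a, c if k < 0. *)
Definition graded_words (k : int) : A -> Prop :=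
  match k with
  | Posz n => sphere_words b d n
  | Negz n => sphere_words a c n.+1
  end.

Lemma graded_words_lin k z x y : graded_words k x -> graded_words k y ->
  graded_words k (z *: x + y).
Proof. by case: k => n; exact: sphere_words_lin. Qed.

Lemma graded_words_up g k x : sphere (a * g) -> sphere (c * g) ->
  (forall n x, sphere_words b d n x -> sphere_words b d n.+1 (x * g)) ->
  graded_words k x -> graded_words (k + 1) (x * g).
Proof.
move=> ag cg up; case: k => n.
  by rewrite -PoszD addn1; exact: up.
case=> u [v [Pu Pv ->]].
have : sphere_words a c n ((u * a + v * c) * g).
  rewrite mulrDl -!mulrA -[u * _]scale1r.
  by apply: sphere_words_lin; apply: sphere_wordsM normalises_ac _ _.
case: n {Pu Pv} => [|n] //.
suff -> : Negz n.+1 + 1 = Negz n by [].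
by rewrite !NegzE -[n.+2]addn1 PoszD opprD addrNK.
Qed.

Lemma graded_words_down g k x : sphere (b * g) -> sphere (d * g) ->
  (forall n x, sphere_words a c n x -> sphere_words a c n.+1 (x * g)) ->
  graded_words k x -> graded_words (k - 1) (x * g).
Proof.
move=> bg dg down; case: k => n; last first.
  have -> : Negz n - 1 = Negz n.+1 by rewrite !NegzE -opprD -PoszD addn1.
  exact: down.
case: n => [|n]; first exact: (down 0%N).
case=> u [v [Pu Pv ->]].
have -> : n.+1%:Z - 1 = n by rewrite -addn1 PoszD addrK.
rewrite mulrDl -!mulrA -[u * _]scale1r.
by apply: sphere_words_lin; apply: sphere_wordsM normalises_bd _ _.
Qed.

(** Right multiplication by b or d adds a letter in degrees >= 0; in negative
    degrees it cancels the last letter, a or c, into an element of the sphere,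
    which is then absorbed.  Similarly for a and c. *)
Lemma degree_graded_words k x : E k x ->
  forall l s, graded_words l s -> graded_words (l + k) (s * x).
Proof.
have wl g h n u : sphere_words g h n u -> sphere_words g h n.+1 (u * g).
  by exists u, 0; rewrite mul0r addr0; split=> //; exact: sphere_words0.
have wr g h n u : sphere_words g h n u -> sphere_words g h n.+1 (u * h).
  by exists 0, u; rewrite mul0r add0r; split=> //; exact: sphere_words0.
elim=> {k x} [k|k w x y _ IHx _ IHy||k m x y _ IHx _ IHy||||] l s Ps.
- by rewrite mulr0; case: (l + k) => n; exact: sphere_words0.
- by rewrite mulrDr -scalerAr; apply: graded_words_lin; [exact: IHx | exact: IHy].
- by rewrite mulr1 addr0.
- by rewrite mulrA addrA; apply/IHy/IHx.
- apply: graded_words_down Ps => //; [exact: sphere_ba | exact: sphere_da |].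
  exact: wl.
- apply: graded_words_up Ps => //; [exact: sphere_bm | exact: sphere_cb |].
  exact: wl.
- apply: graded_words_down Ps => //; [exact: sphere_b0 | exact: sphere_dc |].
  exact: wr.
- apply: graded_words_up Ps => //; [exact: sphere_ad | exact: sphere_bp |].
  exact: wr.
Qed.

Lemma degree0_sphere x : E 0 x -> sphere x.
Proof.
move=> Ex; rewrite -[x]mul1r.
exact: (degree_graded_words Ex (sphere1 : graded_words 0 1)).
Qed.

(** The equation 1 = ad - q cb, inserted into itself between the two letters. *)
Lemma one_lower_raise : 1 = (a * a) * (d * d) - q *: ((a * c) * (b * d))
  - q *: ((c * a) * (d * b)) + (q * q) *: ((c * c) * (b * b)) :> A.
Proof.
have one_sub : 1 = a * d - q *: (c * b) :> A by rewrite -mulbc mulad addrK.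
have ins x y : x * y = x * (a * d) * y - q *: (x * (c * b) * y) :> A.
  by rewrite scalerAl scalerAr -mulrBl -mulrBr -one_sub mulr1.
rewrite {1}one_sub (ins a d) {2}(ins c b) scalerBr opprB [q *: (q *: _)]scalerA.
by rewrite [X in _ - _ + X]addrC !mulrA addrA.
Qed.

Lemma one_raise_lower : 1 = (d * d) * (a * a) - q^-1 *: ((d * b) * (c * a))
  - q^-1 *: ((b * d) * (a * c)) + (q^-1 * q^-1) *: ((b * b) * (c * c)) :> A.
Proof.
have one_sub : 1 = d * a - q^-1 *: (b * c) :> A by rewrite mulda addrK.
have ins x y : x * y = x * (d * a) * y - q^-1 *: (x * (b * c) * y) :> A.
  by rewrite scalerAl scalerAr -mulrBl -mulrBr -one_sub mulr1.
rewrite {1}one_sub (ins d a) {2}(ins b c) scalerBr opprB [q^-1 *: (q^-1 *: _)]scalerA.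
by rewrite [X in _ - _ + X]addrC !mulrA addrA.
Qed.

(** One is a sum of products from degrees -2 and 2. *)
Lemma lower_cancel x y : (forall g, E (-2) g -> x * g = y * g) -> x = y.
Proof.
move=> xy; rewrite -[x]mulr1 -[y]mulr1 one_lower_raise.
rewrite !(mulrBr, mulrDr) -!scalerAr ![_ * (_ * _ * _)]mulrA.
have da := degree_part_a A; have dc := degree_part_c A.
have aa : E (-2) (a * a) := degree_partM da da.
have ac : E (-2) (a * c) := degree_partM da dc.
have ca : E (-2) (c * a) := degree_partM dc da.
have cc : E (-2) (c * c) := degree_partM dc dc.
by rewrite !xy.
Qed.

Lemma raise_cancel x y : (forall f, E 2 f -> x * f = y * f) -> x = y.
Proof.
move=> xy; rewrite -[x]mulr1 -[y]mulr1 one_raise_lower.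
rewrite !(mulrBr, mulrDr) -!scalerAr ![_ * (_ * _ * _)]mulrA.
have db := degree_part_b A; have dd := degree_part_d A.
have bb : E 2 (b * b) := degree_partM db db.
have bd : E 2 (b * d) := degree_partM db dd.
have ddb : E 2 (d * b) := degree_partM dd db.
have ddd : E 2 (d * d) := degree_partM dd dd.
by rewrite !xy.
Qed.

Lemma sphere_degree0 x : sphere x -> E 0 x.
Proof.
have [da db] := (degree_part_a A, degree_part_b A).
have [dc dd] := (degree_part_c A, degree_part_d A).
elim=> {x} [||||z x y _ Ex _ Ey|x y _ Ex _ Ey].
- exact: degree_part1.
- exact: (degree_partM da db).
- exact: (degree_partM db dc).
- exact: (degree_partM dc dd).
- exact: degree_partD.
- exact: (degree_partM Ex Ey).
Qed.

(** A character that tells degrees apart on the elements with eps <> 0, since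
    2 is not a root of unity. *)
Definition eps2 (x : A) : C := eps (scaling 2 x).

Lemma eps2_degree k x : E k x -> eps2 x = 2 ^ k * eps x.
Proof.
by move=> Ex; rewrite /eps2 (scaling_degree _ Ex) ?linearZ ?pnatr_eq0.
Qed.

Lemma eps2_lin k x y : eps2 (k *: x + y) = k * eps2 x + eps2 y.
Proof. by rewrite /eps2 !linearP. Qed.

Lemma eps2M x y : eps2 (x * y) = eps2 x * eps2 y.
Proof. by rewrite /eps2 !rmorphM. Qed.

Lemma eps2_gen : [/\ eps2 a = 2^-1, eps2 b = 0, eps2 c = 0 & eps2 d = 2].
Proof.
have [ea eb ec ed] := eps_gen.
rewrite (eps2_degree (degree_part_a A)) (eps2_degree (degree_part_b A)).
rewrite (eps2_degree (degree_part_c A)) (eps2_degree (degree_part_d A)).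
by rewrite ea eb ec ed !mulr0 !mulr1 expr1z exprN1.
Qed.

End QuantumGroupAlgebra.

(** * Tensors and the coaction on the sphere *)
Section Tensors.
Variable C : numClosedFieldType.

Local Notation bilinear_map f := (bilinear_for *:%R *:%R f).

Section BilinearMaps.
Variables (U V W : lmodType C) (f : U -> V -> W).
Hypothesis fB : bilinear_map f.

Lemma bilinear_l k u u' v : f (k *: u + u') v = k *: f u v + f u' v.
Proof. exact: fB.1. Qed.
Lemma bilinear_r u k v v' : f u (k *: v + v') = k *: f u v + f u v'.
Proof. exact: fB.2. Qed.
Lemma bilinear_0l v : f 0 v = 0.
Proof. by have := bilinear_l (-1) 0 0 v; rewrite !scaleN1r addNr addNr. Qed.
Lemma bilinear_0r u : f u 0 = 0.
Proof. by have := bilinear_r u (-1) 0 0; rewrite !scaleN1r addNr addNr. Qed.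
Lemma bilinear_Zl k u v : f (k *: u) v = k *: f u v.
Proof. by have := bilinear_l k u 0 v; rewrite bilinear_0l !addr0. Qed.
Lemma bilinear_Zr k u v : f u (k *: v) = k *: f u v.
Proof. by have := bilinear_r u k v 0; rewrite bilinear_0r !addr0. Qed.
Lemma bilinear_Dl u u' v : f (u + u') v = f u v + f u' v.
Proof. by have := bilinear_l 1 u u' v; rewrite !scale1r. Qed.
Lemma bilinear_Dr u v v' : f u (v + v') = f u v + f u v'.
Proof. by have := bilinear_r u 1 v v'; rewrite !scale1r. Qed.
Lemma bilinear_suml (I : Type) (s : seq I) (F : I -> U) v :
  f (\sum_(i <- s) F i) v = \sum_(i <- s) f (F i) v.
Proof.
by elim/big_rec2: _ => [|i y1 y2 _ <-]; rewrite ?bilinear_0l ?bilinear_Dl.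
Qed.
Lemma bilinear_sumr (I : Type) (s : seq I) u (F : I -> V) :
  f u (\sum_(i <- s) F i) = \sum_(i <- s) f u (F i).
Proof.
by elim/big_rec2: _ => [|i y1 y2 _ <-]; rewrite ?bilinear_0r ?bilinear_Dr.
Qed.

Lemma tens_eq_bilinear s t : tens_eq s t ->
  \sum_(p <- s) f p.1 p.2 = \sum_(p <- t) f p.1 p.2.
Proof. by apply=> // u v ->; exact: bilinear_0r. Qed.

Lemma bilinear_comp (U' V' : lmodType C) (g : {linear U' -> U})
  (h : {linear V' -> V}) : bilinear_map (fun u v => f (g u) (h v)).
Proof.
by split=> [v|u] k x y; rewrite linearP ?bilinear_l ?bilinear_r.
Qed.

End BilinearMaps.

Lemma tens_eq_intro (U V : lmodType C) (s t : seq (U * V)) :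
  (forall (W : lmodType C) (f : U -> V -> W), bilinear_map f ->
    \sum_(p <- s) f p.1 p.2 = \sum_(p <- t) f p.1 p.2) -> tens_eq s t.
Proof. by move=> st W f fB _; exact: st. Qed.

Lemma sum_tens_scale (U V W : lmodType C) (f : U -> V -> W) k s :
  bilinear_map f ->
  \sum_(p <- tens_scale k s) f p.1 p.2 = k *: \sum_(p <- s) f p.1 p.2.
Proof.
move=> fB; rewrite big_map scaler_sumr; apply: eq_bigr => p _.
by rewrite bilinear_Zl.
Qed.

Lemma sum_tens_mul (A B : algType C) (W : lmodType C) (f : A -> B -> W) s t :
  \sum_(p <- tens_mul s t) f p.1 p.2 =
  \sum_(p <- s) \sum_(r <- t) f (p.1 * r.1) (p.2 * r.2).
Proof. by rewrite big_allpairs_dep. Qed.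

Lemma tens_mul_eq (A B : algType C) (s s' t t' : seq (A * B)) :
  tens_eq s s' -> tens_eq t t' -> tens_eq (tens_mul s t) (tens_mul s' t').
Proof.
move=> ss' tt'; apply: tens_eq_intro => W f fB; rewrite !sum_tens_mul.
transitivity (\sum_(p <- s) \sum_(r <- t') f (p.1 * r.1) (p.2 * r.2)).
  apply: eq_bigr => p _.
  apply: (tens_eq_bilinear (f := fun u v => f (p.1 * u) (p.2 * v))) tt'.
  split=> [v|u] k x y; rewrite mulrDr -scalerAr.
    by rewrite bilinear_l.
  by rewrite bilinear_r.
apply: (tens_eq_bilinear
  (f := fun u v => \sum_(r <- t') f (u * r.1) (v * r.2))) ss'.
split=> [v|u] k x y /=; rewrite scaler_sumr -big_split; apply: eq_bigr => r _ /=.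
  by rewrite mulrDl -scalerAl bilinear_l.
by rewrite mulrDl -scalerAl bilinear_r.
Qed.

Lemma coaction_linear (A : algType C) Delta eps (V W : lmodType C)
    (delta : V -> seq (A * V)) (f : A -> V -> W) k v w :
  left_coaction Delta eps delta -> bilinear_map f ->
  \sum_(p <- delta (k *: v + w)) f p.1 p.2 =
  k *: \sum_(p <- delta v) f p.1 p.2 + \sum_(p <- delta w) f p.1 p.2.
Proof.
case=> dl _ _ fB; rewrite (tens_eq_bilinear fB (dl k v w)) big_cat /=.
by rewrite sum_tens_scale.
Qed.

End Tensors.

Section PodlesCoaction.
Variables (C : numClosedFieldType) (q : C) (A : CqSU2 q).
Local Notation a := (qg_a A).
Local Notation b := (qg_b A).
Local Notation c := (qg_c A).
Local Notation d := (qg_d A).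
Local Notation E := (@degree_part C q A).

Lemma Delta_degree k x : E k x -> exists s : seq (A * A),
  tens_eq (qg_Delta x) s /\ forall p, p \in s -> E k p.2.
Proof.
have [Da Db Dc Dd] := qg_Delta_gen A.
have [ea eb] := (degree_part_a A, degree_part_b A).
have [ec ed] := (degree_part_c A, degree_part_d A).
elim=> {k x} [k|k z x y _ [s [Ds Es]] _ [t [Dt Et]]||
  k l x y _ [s [Ds Es]] _ [t [Dt Et]]||||].
- exists [::]; split=> //; apply: tens_eq_intro => W f fB.
  rewrite big_nil -[X in qg_Delta X](scaler0 A (-1)) -[_ *: 0]addr0.
  by rewrite (coaction_linear _ _ _ (qg_Delta_coaction A)) // scaleN1r addNr.
- exists (tens_scale z s ++ t); split.
    apply: tens_eq_intro => W f fB.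
    rewrite (coaction_linear _ _ _ (qg_Delta_coaction A)) // big_cat /=.
    by rewrite sum_tens_scale // (tens_eq_bilinear fB Ds) (tens_eq_bilinear fB Dt).
  move=> p; rewrite mem_cat => /orP[/mapP[r /Es Er ->]|/Et]; last by [].
  exact: Er.
- exists [:: (1, 1)]; split; first exact: qg_Delta1.
  by move=> p; rewrite inE => /eqP->; exact: degree_part1.
- exists (tens_mul s t); split.
    apply: tens_eq_intro => W f fB.
    by rewrite (tens_eq_bilinear fB (qg_DeltaM x y)) (tens_eq_bilinear fB
      (tens_mul_eq Ds Dt)).
  by move=> p /allpairsP[[r1 r2] /= [/Es E1 /Et E2 ->]]; exact: degree_partM.
- exists [:: (a, a); (b, c)]; split=> // p.
  by rewrite !inE => /orP[] /eqP->.
- exists [:: (a, b); (b, d)]; split=> // p.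
  by rewrite !inE => /orP[] /eqP->.
- exists [:: (c, a); (d, c)]; split=> // p.
  by rewrite !inE => /orP[] /eqP->.
- exists [:: (c, b); (d, d)]; split=> // p.
  by rewrite !inE => /orP[] /eqP->.
Qed.

Definition podles_of (x : A) (Ex : E 0 x) : podles A :=
  Podles (introT (asboolP _) Ex : podles_pred x).

Lemma podles_degree (m : podles A) : E 0 (\val m).
Proof. by case: m => x /= /asboolP. Qed.

Lemma podles_Delta (m : podles A) : exists s : seq (A * podles A),
  tens_eq (qg_Delta (\val m)) [seq (p.1, \val p.2) | p <- s].
Proof.
have [s [Ds Es]] := Delta_degree (podles_degree m).
suff [t st] : exists t : seq (A * podles A), s = [seq (p.1, \val p.2) | p <- t].
  by exists t; rewrite -st.
elim: s Es {Ds} => [|[x y] s IH] Es; first by exists [::].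
have [|t st] := IH; first by move=> p ps; apply: Es; rewrite inE ps orbT.
have Ey : E 0 y by apply: (Es (x, y)); rewrite inE eqxx.
by exists ((x, podles_of Ey) :: t); rewrite st.
Qed.

End PodlesCoaction.

(** * Coordinates of forms *)
Section Dolbeault.
Variables (C : numClosedFieldType) (q : C) (A : CqSU2 q).
Hypothesis q0 : q != 0.
Variable Om : dolbeault_complex A.

Local Notation a := (qg_a A).
Local Notation b := (qg_b A).
Local Notation c := (qg_c A).
Local Notation d := (qg_d A).
Local Notation eps := (qg_eps A).
Local Notation E := (@degree_part C q A).
Local Notation bilinear_map f := (bilinear_for *:%R *:%R f).
Local Notation delta := (@db_delta C q A Om).
Local Notation coord := (is_coord delta).
Local Notation N := (Mplus_span (Om := Om) setT).
Local Notation incl := (cl_in Om).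
Local Notation dd := (cl_d Om).
Local Notation del := (db_del Om).
Local Notation delbar := (db_delbar Om).
Local Notation bi := (@db_bi C q A Om).

Lemma eps_lin k x y : (eps (k *: x + y) : C) = k * eps x + eps y.
Proof. exact: linearP. Qed.

Lemma delta_coaction : left_coaction (@qg_Delta _ _ A) eps delta.
Proof. by case: (db_covariant Om). Qed.

Lemma sum_delta_linear (W : lmodType C) (f : A -> Om -> W) k v w :
  bilinear_map f -> \sum_(p <- delta (k *: v + w)) f p.1 p.2 =
  k *: \sum_(p <- delta v) f p.1 p.2 + \sum_(p <- delta w) f p.1 p.2.
Proof. exact: coaction_linear delta_coaction. Qed.

Lemma sum_coord (W : lmodType C) (f : A -> Om -> W) x u w :
  bilinear_map f -> (forall u v, N v -> f u v = 0) -> coord x u w ->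
  \sum_(p <- delta w) f p.1 p.2 = f x u.
Proof. by move=> fB fN xw; rewrite (xw _ f fB fN) big_seq1. Qed.

Lemma coord_intro x u w : (forall (W : lmodType C) (f : A -> Om -> W),
    bilinear_map f -> (forall u v, N v -> f u v = 0) ->
    \sum_(p <- delta w) f p.1 p.2 = f x u) -> coord x u w.
Proof. by move=> H W f fB fN; rewrite big_seq1 H. Qed.

Lemma coord_lin k x y u v w :
  coord x u v -> coord y u w -> coord (k *: x + y) u (k *: v + w).
Proof.
move=> xv yw; apply: coord_intro => W f fB fN.
by rewrite sum_delta_linear // (sum_coord fB fN xv) (sum_coord fB fN yw)
  (bilinear_l fB).
Qed.

Lemma coord_inj x u v w : coord x u v -> coord x u w -> v = w.
Proof.
move=> xv xw; apply/eqP; rewrite eq_sym -subr_eq0; apply/eqP.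
apply: (db_identification (d := Om)) => W f fB fN.
rewrite addrC -scaleN1r sum_delta_linear // (sum_coord fB fN xv).
by rewrite (sum_coord fB fN xw) scaleN1r addNr big_nil.
Qed.

Lemma coord_zero u : coord 0 u 0.
Proof.
apply: coord_intro => W f fB _; rewrite (bilinear_0l fB).
by rewrite -[0 : Om](addNr 0) -scaleN1r sum_delta_linear // scaleN1r addNr.
Qed.

Lemma coordZ k x u w : coord x u w -> coord (k *: x) u (k *: w).
Proof.
move=> xw; rewrite -[k *: x]addr0 -[k *: w]addr0.
exact: coord_lin xw (coord_zero u).
Qed.

Lemma coordD x y u v w : coord x u v -> coord y u w -> coord (x + y) u (v + w).
Proof.
by move=> xv yw; rewrite -[x]scale1r -[v]scale1r; exact: coord_lin.
Qed.

Lemma sum_delta0 (W : lmodType C) (f : A -> Om -> W) :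
  bilinear_map f -> \sum_(p <- delta 0) f p.1 p.2 = 0.
Proof.
move=> fB; rewrite -[0 : Om](addNr 0) -scaleN1r sum_delta_linear // scaleN1r.
exact: addNr.
Qed.

(** The form w is eps(x) u modulo M^+ Omega.  Membership is expressed through
    bilinear maps: apply the coordinate to eps(v) f(y, z) and use the counit
    axiom. *)
Lemma coord_eps (W : lmodType C) (f : A -> Om -> W) x u w y :
  bilinear_map f -> (forall u v, N v -> f u v = 0) -> coord x u w ->
  f y w = (eps x : C) *: f y u.
Proof.
move=> fB fN xw; pose g (v : A) (z : Om) := (eps v : C) *: f y z.
have gB : bilinear_map g.
  split=> [z|v] k s t; rewrite /g.
    by rewrite /= eps_lin scalerDl scalerA.
  rewrite /= (bilinear_r fB) scalerDr !scalerA; congr (_ *: _ + _); exact: mulrC.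
have gN v z : N z -> g v z = 0 by move=> Nz; rewrite /g fN // scaler0.
rewrite -[RHS]/(g x u) -(sum_coord gB gN xw); have [_ counit _] := delta_coaction.
rewrite -[in LHS](counit w) (bilinear_sumr fB); apply: eq_bigr => p _.
by rewrite (bilinear_Zr fB).
Qed.

(** A covariant family of forms has coordinates determined by the counits of the
    coordinates of its members. *)
Lemma coord_covariant (T : Type) (s : seq (A * T)) (u : T -> Om) (g : T -> A)
    x w : tens_eq (delta w) [seq (p.1, u p.2) | p <- s] ->
  (forall t, coord (g t) x (u t)) ->
  coord (\sum_(p <- s) (eps (g p.2) : C) *: p.1) x w.
Proof.
move=> ws gu; apply: coord_intro => W f fB fN.
rewrite (tens_eq_bilinear fB ws) big_map (bilinear_suml fB); apply: eq_bigr => p _.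
by rewrite (bilinear_Zl fB) (coord_eps _ fB fN (gu _)).
Qed.

Lemma delta_incl (m : podles A) (s : seq (A * podles A)) :
  tens_eq (qg_Delta (\val m)) [seq (p.1, \val p.2) | p <- s] ->
  tens_eq (delta (incl m)) [seq (p.1, incl p.2) | p <- s].
Proof. by case: (db_covariant Om) => _ + _ _; apply. Qed.

Lemma delta_d w : tens_eq (delta (dd w)) (tens_map id dd (delta w)).
Proof. by case: (db_covariant Om). Qed.

Lemma coord_lmul (m : podles A) x u w :
  coord x u w -> coord (\val m * x) u (incl m * w).
Proof.
move=> xw; apply: coord_intro => W f fB fN.
have [s Ds] := podles_Delta m.
have dmw : tens_eq (delta (incl m * w)) (tens_mul (delta (incl m)) (delta w)).
  by case: (db_covariant Om).
rewrite (tens_eq_bilinear fB dmw).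
have dm : tens_eq (delta w) (delta w) by [].
rewrite (tens_eq_bilinear fB (tens_mul_eq (delta_incl Ds) dm)) sum_tens_mul.
have gB y (v : Om) : bilinear_map (fun y' v' => f (y * y') (v * v')).
  split=> [z|z] k s' t; rewrite mulrDr -scalerAr; [exact: (bilinear_l fB)|exact:
    (bilinear_r fB)].
have fm : bilinear_map (fun y' v' => f (\val m * y') v').
  split=> [z|z] k s' t; last exact: (bilinear_r fB).
  by rewrite mulrDr -scalerAr; exact: (bilinear_l fB).
rewrite -(sum_coord fm _ xw); last by move=> y v; exact: fN.
rewrite big_map exchange_big /=; apply: eq_bigr => r _.
(* p_2 r_2 and eps(p_2) r_2 differ by an element of M^+ Omega. *)
have epsm (p : A * podles A) : f (p.1 * r.1) (incl p.2 * r.2) =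
    f ((eps (\val p.2) : C) *: p.1 * r.1) r.2.
  apply/eqP; rewrite -scalerAl (bilinear_Zl fB) -(bilinear_Zr fB) -subr_eq0.
  rewrite -[X in _ - X](scale1r) -scaleNr addrC -(bilinear_r fB) scaleN1r.
  rewrite addrC; apply/eqP/fN; exists [:: (p.2 - (eps (\val p.2) : C) *: 1,
    r.2)]; split.
    move=> p'; rewrite inE => /eqP-> /=; split=> //.
    have -> : podles_eps (p.2 - (eps (\val p.2) : C) *: 1) =
        eps (\val p.2 - (eps (\val p.2) : C) *: 1).
      by rewrite /podles_eps; congr (eps _); rewrite linearB linearZ /= ?rmorph1.
    by rewrite addrC -scaleNr eps_lin rmorph1 mulr1 addNr.
  rewrite big_seq1.
  transitivity ((incl p.2 - (eps (\val p.2) : C) *: 1) * r.2).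
    by rewrite mulrBl -scalerAl mul1r.
  congr (_ * _); rewrite (linearB incl) (linearZZ incl).
  congr (_ - _ *: _); exact/esym/rmorph1.
under eq_bigr do rewrite epsm.
rewrite -(bilinear_suml fB) -mulr_suml; congr (f (_ * _) _).
rewrite -[in RHS](qg_Delta_counitr (\val m)).
have eB : bilinear_map (fun u v : A => (eps v : C) *: u).
  split=> [z|z] k s' t /=; last by rewrite eps_lin scalerDl scalerA.
  by rewrite scalerDr !scalerA; congr (_ *: _ + _); exact: mulrC.
by rewrite (tens_eq_bilinear eB Ds) big_map.
Qed.


(** * The bigrading *)
Lemma bi_subspace p r : subspace (bi p r).
Proof.
have [gr _ _ _ _] := db_almost_complex Om.
by have [sub _ _] := gr; exact: (sub (p, r)).
Qed.

Lemma bi_form p r w : bi p r w -> cl_form (c := Om) (p + r) w.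
Proof.
have [_ _ form _ _] := db_almost_complex Om; move=> bw; apply/form.
exists (fun i : 'I_(p + r).+1 => if i == p :> nat then w else 0); split=> [i|].
  by case: eqP => [->|_]; [rewrite addKn | case: (bi_subspace i (p + r - i))].
have pr : (p < (p + r).+1)%N by rewrite ltnS leq_addr.
rewrite (bigD1 (Ordinal pr)) //= eqxx big1 ?addr0 // => i.
by rewrite -val_eqE /= => /negPf->.
Qed.

Lemma bi_gt2 p r w : (2 < p + r)%N -> bi p r w -> w = 0.
Proof. by move=> pr /bi_form; rewrite db_form_gt2. Qed.

Lemma bi_disjoint p r p' r' w :
  bi p r w -> bi p' r' w -> (p, r) != (p', r') -> w = 0.
Proof.
move=> bw bw' pr; have [[_ _ indep] _ _ _ _] := db_almost_complex Om.
pose u i := if i == (p, r) then w else if i == (p', r') then - w else 0.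
have bu i : bi i.1 i.2 (u i).
  rewrite /u; case: eqP => [->//|_]; case: eqP => [->|_].
    by rewrite -scaleN1r; apply: subspaceZ => //; exact: bi_subspace.
  by case: (bi_subspace i.1 i.2).
have us : uniq [:: (p, r); (p', r')] by rewrite /= inE pr.
have sum0 : \sum_(i <- [:: (p, r); (p', r')]) u i = 0.
  rewrite !big_cons big_nil /u !eqxx [_ == (p, r)]eq_sym (negPf pr) addr0.
  exact: subrr.
have := indep _ _ us bu sum0 (p, r); rewrite /u inE !eqxx; exact.
Qed.

Lemma bi20 w : bi 2 0 w -> w = 0.
Proof.
move=> bw; apply: (@bi_disjoint 2 0 1 1) => //.
by rewrite -(db_form2 Om); exact: bi_form bw.
Qed.

Lemma bi02 w : bi 0 2 w -> w = 0.
Proof.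
move=> bw; apply: (@bi_disjoint 0 2 1 1) => //.
by rewrite -(db_form2 Om); exact: bi_form bw.
Qed.

Lemma bi00E w : bi 0 0 w <-> exists m, w = incl m.
Proof.
have form0 : cl_form (c := Om) 0 w <-> exists m, w = incl m.
  by rewrite cl_form0; split=> [[m _ <-]|[m ->]]; [exists m | exists m].
split=> [/bi_form/form0 //|/form0].
have [_ _ form _ _] := db_almost_complex Om.
by move/form => [u [bu ->]]; rewrite big_ord1; exact: (bu ord0).
Qed.

Lemma bi_incl m : bi 0 0 (incl m). Proof. by apply/bi00E; exists m. Qed.

Lemma bi_mul p r p' r' w v :
  bi p r w -> bi p' r' v -> bi (p + p') (r + r') (w * v).
Proof. by case: (db_almost_complex Om) => _ + _ _ _; apply. Qed.

Lemma bi_span w : exists w0 w1 w1' w2,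
  [/\ bi 0 0 w0, bi 1 0 w1, bi 0 1 w1' & bi 1 1 w2] /\ w = w0 + w1 + w1' + w2.
Proof.
have [[_ span _] _ _ _ _] := db_almost_complex Om.
have [s [u [_ bu ->]]] := span w; elim: s => [|[p r] s [w0 [w1 [w1' [w2 [[b0 b1
  b1' b2] sE]]]]]].
  by exists 0, 0, 0, 0; rewrite big_nil !addr0; split=> //; split;
     apply: (proj1 (bi_subspace _ _)).
have add p' r' x y : bi p' r' x -> bi p' r' y -> bi p' r' (x + y).
  by move=> bx bY; rewrite -[x]scale1r; exact: (proj2 (bi_subspace _ _)).
rewrite big_cons sE; have := bu (p, r); move: (u (p, r)) => x /=.
case: p => [|[|p]]; case: r => [|[|r]] bx.
- by exists (x + w0), w1, w1', w2; rewrite !addrA; split=> //; split=> //; exact: add.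
- exists w0, w1, (x + w1'), w2; split; first by split=> //; exact: add.
  by rewrite [LHS](AC (1*4) ((2*3)*(1*4)*5)).
- have -> : x = 0 by case: r bx => [/bi02|r /bi_gt2 ->].
  by exists w0, w1, w1', w2; rewrite add0r.
- exists w0, (x + w1), w1', w2; split; first by split=> //; exact: add.
  by rewrite [LHS](AC (1*4) (2*(1*3)*4*5)).
- exists w0, w1, w1', (x + w2); split; first by split=> //; exact: add.
  by rewrite [LHS](AC (1*4) ((2*3*4)*(1*5))).
- by rewrite (bi_gt2 _ bx) //; exists w0, w1, w1', w2; rewrite add0r.
- have -> : x = 0 by case: p bx => [/bi20|p /bi_gt2 ->].
  by exists w0, w1, w1', w2; rewrite add0r.
- by rewrite (bi_gt2 _ bx) ?addn1 //; exists w0, w1, w1', w2; rewrite add0r.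
- by rewrite (bi_gt2 _ bx) ?addnS //; exists w0, w1, w1', w2; rewrite add0r.
Qed.

Lemma bi_indep w0 w1 w1' w2 : bi 0 0 w0 -> bi 1 0 w1 -> bi 0 1 w1' ->
  bi 1 1 w2 -> w0 + w1 + w1' + w2 = 0 ->
  [/\ w0 = 0, w1 = 0, w1' = 0 & w2 = 0].
Proof.
move=> b0 b1 b1' b2 sum0; have [[_ _ indep] _ _ _ _] := db_almost_complex Om.
pose u (i : nat * nat) := match i with
  | (O, O) => w0 | (S O, O) => w1 | (O, S O) => w1' | (S O, S O) => w2
  | _ => 0 end.
have bu i : bi i.1 i.2 (u i).
  by case: i => [[|[|p]] [|[|r]]] //=; exact: (proj1 (bi_subspace _ _)).
have us : uniq [:: (0, 0); (1, 0); (0, 1); (1, 1)]%N by [].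
have su0 : \sum_(i <- [:: (0, 0); (1, 0); (0, 1); (1, 1)]%N) u i = 0.
  by rewrite !big_cons big_nil /= addr0 !addrA.
have all0 := indep _ _ us bu su0.
split; [exact: (all0 (0, 0)%N) | exact: (all0 (1, 0)%N)
  | exact: (all0 (0, 1)%N) | exact: (all0 (1, 1)%N)].
Qed.

(** The linear projections that keep or kill the forms of type (1,0), as z says,
    and those of type (0,1), as z' says. *)
Lemma projection_exists (z z' : bool) : exists pr : {linear Om -> Om},
  (forall w, bi 1 0 w -> pr w = if z then w else 0) /\
  (forall w, bi 0 1 w -> pr w = if z' then w else 0).
Proof.
have ex w : exists v, exists w0 w1 w1' w2, [/\ bi 0 0 w0, bi 1 0 w1, bi 0 1 w1'
    & bi 1 1 w2] /\ w = w0 + w1 + w1' + w2 /\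
    v = (if z then w1 else 0) + (if z' then w1' else 0).
  have [w0 [w1 [w1' [w2 [H wE]]]]] := bi_span w.
  by eexists; exists w0, w1, w1', w2; split; [exact: H | split].
pose pr w := sval (cid (ex w)).
have prE w0 w1 w1' w2 : bi 0 0 w0 -> bi 1 0 w1 -> bi 0 1 w1' -> bi 1 1 w2 ->
    pr (w0 + w1 + w1' + w2) = (if z then w1 else 0) + (if z' then w1' else 0).
  move=> b0 b1 b1' b2; rewrite /pr; case: cid => v /=.
  move=> [v0 [v1 [v1' [v2 [[c0 c1 c1' c2] [wE ->]]]]]].
  have sub p r x y : bi p r x -> bi p r y -> bi p r (x - y).
    by move=> bx bY; apply: subspaceB => //; exact: bi_subspace.
  have [|_ /subr0_eq-> /subr0_eq-> _ //] := bi_indep (sub _ _ _ _ b0 c0)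
    (sub _ _ _ _ b1 c1) (sub _ _ _ _ b1' c1') (sub _ _ _ _ b2 c2).
  apply/eqP; rewrite [X in X == _](AC (2*2*2*2) ((1*3*5*7)*(2*4*6*8))) /=.
  by rewrite -!opprD subr_eq0 wE.
have sub0 p r : bi p r 0 by case: (bi_subspace p r).
have pr_linear : linear pr.
  move=> k x y; have [x0 [x1 [x1' [x2 [[b0 b1 b1' b2] xE]]]]] := bi_span x.
  have [y0 [y1 [y1' [y2 [[c0 c1 c1' c2] yE]]]]] := bi_span y.
  have lin p r u v : bi p r u -> bi p r v -> bi p r (k *: u + v).
    exact: (proj2 (bi_subspace p r)).
  have -> : k *: x + y =
      (k *: x0 + y0) + (k *: x1 + y1) + (k *: x1' + y1') + (k *: x2 + y2).
    rewrite xE yE !scalerDr.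
    by rewrite [RHS](AC (2*2*2*2) ((1*3*5*7)*(2*4*6*8))).
  rewrite prE; try exact: lin.
  have ifl (t : bool) (u v : Om) : (if t then k *: u + v else 0) =
      k *: (if t then u else 0) + (if t then v else 0).
    by case: t; rewrite ?scaler0 ?addr0.
  by rewrite xE yE !prE // !ifl scalerDr addrACA.
pose prL : {linear Om -> Om} := HB.pack pr (GRing.isLinear.Build C Om Om *:%R pr
  pr_linear).
exists prL; split=> w bw; rewrite -[prL w]/(pr w).
  have := prE 0 w 0 0 (sub0 _ _) bw (sub0 _ _) (sub0 _ _).
  by rewrite add0r !addr0 if_same addr0.
have := prE 0 0 w 0 (sub0 _ _) (sub0 _ _) bw (sub0 _ _).
by rewrite !add0r !addr0 if_same add0r.
Qed.

Lemma del_incl m : bi 1 0 (del (incl m)).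
Proof. exact: db_del_bi (bi_incl m). Qed.

Lemma delbar_incl m : bi 0 1 (delbar (incl m)).
Proof. exact: db_delbar_bi (bi_incl m). Qed.

Lemma d_del w : bi 1 0 w -> dd w = delbar w.
Proof.
by move=> bw; rewrite db_d_split (bi20 (db_del_bi bw)) add0r.
Qed.

Lemma d_delbar w : bi 0 1 w -> dd w = del w.
Proof.
by move=> bw; rewrite db_d_split (bi02 (db_delbar_bi bw)) addr0.
Qed.

(** The coaction commutes with d and preserves each bidegree, hence commutes with
    each component of d. *)
Lemma split_covariant (z z' : bool) (pr : {linear Om -> Om}) (m : podles A)
    (s : seq (A * podles A)) :
  (forall w, bi 1 0 w -> pr w = if z then w else 0) ->
  (forall w, bi 0 1 w -> pr w = if z' then w else 0) ->
  tens_eq (qg_Delta (\val m)) [seq (p.1, \val p.2) | p <- s] ->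
  tens_eq (delta (pr (dd (incl m)))) [seq (p.1, pr (dd (incl p.2))) | p <- s].
Proof.
move=> pr1 pr2 Ds; apply: tens_eq_intro => W f fB.
have fprB : bilinear_map (fun u v => f u (pr v)).
  exact: (bilinear_comp fB idfun pr).
have fprdB : bilinear_map (fun u v => f u (pr (dd v))).
  exact: (bilinear_comp fB idfun (pr \o dd)).
have -> : \sum_(p <- [seq (p.1, pr (dd (incl p.2))) | p <- s]) f p.1 p.2 =
    \sum_(p <- delta (dd (incl m))) f p.1 (pr p.2).
  apply/esym/(etrans (tens_eq_bilinear fprB (delta_d _))); rewrite [LHS]big_map.
  by apply/(etrans (tens_eq_bilinear fprdB (delta_incl Ds))); rewrite !big_map.
have split1 p r w (t : bool) : bi p r w -> 
    (forall w, bi p r w -> pr w = if t then w else 0) ->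
    \sum_(p <- delta (pr w)) f p.1 p.2 = \sum_(p <- delta w) f p.1 (pr p.2).
  move=> bw prw; have [s' [bs' ws']] := db_covariant_complex bw.
  apply/esym/(etrans (tens_eq_bilinear fprB ws')); rewrite prw // big_seq.
  case: t prw => prw.
    rewrite [RHS](tens_eq_bilinear fB ws') [RHS]big_seq.
    by apply: eq_bigr => r' /bs' br'; rewrite prw.
  rewrite big1 => [|r' /bs' br']; last by rewrite prw // (bilinear_0r fB).
  by rewrite sum_delta0.
rewrite db_d_split linearD -[pr (del _)]scale1r sum_delta_linear //.
rewrite -[del _]scale1r (sum_delta_linear _ _ _ fprB) !scale1r.
congr (_ + _); [exact: split1 (del_incl m) pr1 | exact: split1 (delbar_incl m) pr2].
Qed.

Lemma del_covariant (m : podles A) (s : seq (A * podles A)) :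
  tens_eq (qg_Delta (\val m)) [seq (p.1, \val p.2) | p <- s] ->
  tens_eq (delta (del (incl m))) [seq (p.1, del (incl p.2)) | p <- s].
Proof.
have [pr [pr1 pr2]] := projection_exists true false.
have prd m' : del (incl m') = pr (dd (incl m')).
  by rewrite db_d_split linearD /= pr1 ?pr2 ?addr0 //; [exact: delbar_incl |
    exact: del_incl].
move=> Ds; rewrite prd; have := @split_covariant true false pr m s pr1 pr2 Ds.
by congr tens_eq; apply: eq_map => p; rewrite -prd.
Qed.

Lemma delbar_covariant (m : podles A) (s : seq (A * podles A)) :
  tens_eq (qg_Delta (\val m)) [seq (p.1, \val p.2) | p <- s] ->
  tens_eq (delta (delbar (incl m))) [seq (p.1, delbar (incl p.2)) | p <- s].
Proof.
have [pr [pr1 pr2]] := projection_exists false true.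
have prd m' : delbar (incl m') = pr (dd (incl m')).
  by rewrite db_d_split linearD /= pr1 ?pr2 ?add0r //; [exact: delbar_incl |
    exact: del_incl].
move=> Ds; rewrite prd; have := @split_covariant false true pr m s pr1 pr2 Ds.
by congr tens_eq; apply: eq_map => p; rewrite -prd.
Qed.

Lemma delbar_del_covariant (m : podles A) (s : seq (A * podles A)) :
  tens_eq (qg_Delta (\val m)) [seq (p.1, \val p.2) | p <- s] ->
  tens_eq (delta (delbar (del (incl m))))
    [seq (p.1, delbar (del (incl p.2))) | p <- s].
Proof.
move=> /del_covariant Ds; rewrite -(d_del (del_incl m)).
apply: tens_eq_intro => W f fB.
rewrite (tens_eq_bilinear fB (delta_d _)) big_map.
have fdB : bilinear_map (fun u v => f u (dd v)).
  exact: (bilinear_comp fB idfun dd).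
apply: (etrans (tens_eq_bilinear fdB Ds)); rewrite !big_map.
by apply: eq_bigr => p _; rewrite (d_del (del_incl _)).
Qed.

(** * The operators del and delbar in coordinates *)

Definition podles_b0 : podles A := podles_of (sphere_degree0 (sphere_b0 A)).

Definition podles_ad : podles A := podles_of (sphere_degree0 (sphere_ad A)).

Lemma podles_adE : podles_ad = 1 + q *: podles_b0.
Proof.
apply: val_inj; rewrite /= mulad.
by [].
Qed.

Lemma Delta_bm : tens_eq (qg_Delta (a * b))
  [:: (a * a, a * b); (a * b, a * d); (b * a, b * c); (b * b, c * d)].
Proof.
have [Da Db Dc Dd] := qg_Delta_gen A.
apply: tens_eq_intro => W f fB.
rewrite (tens_eq_bilinear fB (qg_DeltaM a b)).
by rewrite (tens_eq_bilinear fB (tens_mul_eq Da Db)) /tens_mul /= (mulbc A).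
Qed.

Lemma Delta_b0 : tens_eq (qg_Delta (b * c))
  [:: (c * a, a * b); (c * b, a * d); (d * a, b * c); (d * b, c * d)].
Proof.
have [Da Db Dc Dd] := qg_Delta_gen A.
apply: tens_eq_intro => W f fB; rewrite {1}(mulbc A).
rewrite (tens_eq_bilinear fB (qg_DeltaM c b)).
by rewrite (tens_eq_bilinear fB (tens_mul_eq Dc Db)) /tens_mul /= (mulbc A).
Qed.

Lemma Delta_bp : tens_eq (qg_Delta (c * d))
  [:: (c * c, a * b); (c * d, a * d); (d * c, b * c); (d * d, c * d)].
Proof.
have [Da Db Dc Dd] := qg_Delta_gen A.
apply: tens_eq_intro => W f fB.
rewrite (tens_eq_bilinear fB (qg_DeltaM c d)).
by rewrite (tens_eq_bilinear fB (tens_mul_eq Dc Dd)) /tens_mul /= (mulbc A).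
Qed.

(** Let u be a covariant map from the sphere to a line of degree k, and r, s, t
    the counits of the coordinates of u(b_-), u(b_0), u(b_+).  The coproducts of
    the b_i express the coordinates through r, s, t, and eps2 of a coordinate is
    2^k times its counit; this leaves at most one of r, s, t free. *)
Lemma podles_rows (k : int) (x : Om) (u : podles A -> Om) :
  (forall (m : podles A) (s : seq (A * podles A)),
     tens_eq (qg_Delta (\val m)) [seq (p.1, \val p.2) | p <- s] ->
     tens_eq (delta (u m)) [seq (p.1, u p.2) | p <- s]) ->
  (forall m, exists2 f, E k f & coord f x (u m)) ->
  (forall f f' w, coord f x w -> coord f' x w -> f = f') ->
  (forall z m n, u (z *: m + n) = z *: u m + u n) -> u 1 = 0 ->
  exists r s t : C,
  [/\ coord (r *: (a * a) + s *: (q *: (a * b) + b * a) + t *: (b * b)) x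
        (u (podles_bm A)),
      coord (r *: (c * a) + s *: (q *: (c * b) + d * a) + t *: (d * b)) x
        (u podles_b0),
      coord (r *: (c * c) + s *: (q *: (c * d) + d * c) + t *: (d * d)) x
        (u (podles_bp A))
    & [/\ 2^-1 * 2^-1 * r = 2 ^ k * r, s = 2 ^ k * s & 2 * 2 * t = 2 ^ k * t]].
Proof.
move=> cov crd uniq ul u1.
have /choice[g gE] : forall m, exists f, E k f /\ coord f x (u m).
  by move=> m; have [f] := crd m; exists f.
have gad : g podles_ad = q *: g podles_b0.
  apply: (uniq _ _ (u podles_ad)); first by case: (gE podles_ad).
  rewrite podles_adE addrC ul u1 addr0.
  by apply: coordZ; case: (gE podles_b0).
pose e m : C := eps (g m).
have row (m : podles A) (x1 x2 x3 x4 : A) : tens_eq (qg_Delta (\val m))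
    [:: (x1, a * b); (x2, a * d); (x3, b * c); (x4, c * d)] ->
  g m = e (podles_bm A) *: x1 + e podles_b0 *: (q *: x2 + x3) +
    e (podles_bp A) *: x4.
  move=> Dm; apply: (uniq _ _ (u m)); first by case: (gE m).
  pose s : seq (A * podles A) :=
    [:: (x1, podles_bm A); (x2, podles_ad); (x3, podles_b0); (x4, podles_bp A)].
  have := @coord_covariant _ s u g x (u m) (cov m s Dm) (fun t => proj2 (gE t)).
  rewrite !big_cons big_nil /= addr0 gad; congr (coord _ _ _).
  rewrite scalerDr scalerA !addrA; congr (_ + _ *: _ + _ + _).
  by rewrite linearZ /= mulrC.
have ge m : eps2 (g m) = 2 ^ k * e m by case: (gE m) => /eps2_degree.
have [ea eb ec ed] := eps2_gen A.
have rm := row (podles_bm A) _ _ _ _ Delta_bm.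
have r0 := row podles_b0 _ _ _ _ Delta_b0.
have rp := row (podles_bp A) _ _ _ _ Delta_bp.
exists (e (podles_bm A)), (e podles_b0), (e (podles_bp A)); split.
- by rewrite -rm; case: (gE (podles_bm A)).
- by rewrite -r0; case: (gE podles_b0).
- by rewrite -rp; case: (gE (podles_bp A)).
have eps2Z z y : eps2 (z *: y) = z * eps2 y :> C.
  by rewrite -[z *: y]addr0 eps2_lin /eps2 !linear0 addr0.
have eps2D y z : eps2 (y + z) = eps2 y + eps2 z :> C.
  by rewrite -[y]scale1r eps2_lin mul1r scale1r.
split.
- rewrite -[RHS](ge (podles_bm A)) rm !(eps2D, eps2Z, eps2M) ea eb; ring.
- rewrite -[RHS](ge podles_b0) r0 !(eps2D, eps2Z, eps2M) ea eb ec ed; by field.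
- rewrite -[RHS](ge (podles_bp A)) rp !(eps2D, eps2Z, eps2M) ec ed; ring.
Qed.


Local Notation ep := (e_plus Om).
Local Notation em := (e_minus Om).
Local Notation tau := (form_tau Om).

Lemma line_coord k x S w : is_line delta k x S -> S w ->
  exists2 f, E k f & coord f x w.
Proof. by case=> _ + _ Sw; apply. Qed.

Lemma line_form k x S f : is_line delta k x S -> E k f ->
  exists2 w, S w & coord f x w.
Proof. by case=> + _ _ Ef; apply. Qed.

Lemma line_mem k x S f w : is_line delta k x S -> E k f -> coord f x w -> S w.
Proof. by case=> line _ _ /line[v Sv fv] fw; rewrite (coord_inj fw fv). Qed.

Lemma line_uniq k x S f f' w : is_line delta k x S ->
  coord f x w -> coord f' x w -> f = f'.
Proof. by case=> _ _ +; apply. Qed.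

(** The hypothesis says that z x = x modulo M^+ Omega; and x is not in M^+ Omega. *)
Lemma line_scalar k x S (z : C) : is_line delta k x S ->
  (forall (W : lmodType C) (f : A -> Om -> W), bilinear_map f ->
     (forall u v, N v -> f u v = 0) -> forall y, z *: f y x = f y x) -> z = 1.
Proof.
move=> line zx; have H : coord ((z - 1) *: 1) x 0.
  apply: coord_intro => W f fB fN; rewrite sum_delta0 // (bilinear_Zl fB).
  by rewrite scalerBl zx // scale1r subrr.
have := line_uniq line H (coord_zero x) => /eqP.
by rewrite scaler_eq0 oner_eq0 orbF subr_eq0 => /eqP.
Qed.

Lemma del_delbar1 : del (incl 1) = 0 /\ delbar (incl 1) = 0.
Proof.
have d1 : dd (incl 1) = 0.
  have i1 : incl 1 = 1 by exact: rmorph1.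
  have f1 : cl_form (c := Om) 0 (incl 1) by rewrite cl_form0; exists 1.
  have := cl_leibniz (incl 1) f1; rewrite i1 !mulr1 mul1r scale1r => /eqP.
  by rewrite -subr_eq subrr => /eqP <-.
have := bi_indep (proj1 (bi_subspace 0 0)) (del_incl 1) (delbar_incl 1)
  (proj1 (bi_subspace 1 1)).
by rewrite add0r addr0 -db_d_split d1 => /(_ erefl)[].
Qed.

(** Only t survives in degree 2 and only r in degree -2.  They are 1 because
    d b_+ and d b_- are the forms with respect to which coordinates are taken. *)
Lemma del_delbar_generators :
  [/\ coord (b * b) ep (del (incl (podles_bm A))),
      coord (d * b) ep (del (incl podles_b0))
    & coord (d * d) ep (del (incl (podles_bp A)))] /\
  [/\ coord (a * a) em (delbar (incl (podles_bm A))),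
      coord (c * a) em (delbar (incl podles_b0))
    & coord (c * c) em (delbar (incl (podles_bp A)))].
Proof.
have line1 := db_form10 Om; have line1' := db_form01 Om.
have [del1 delbar1] := del_delbar1.
have ul (f : {linear Om -> Om}) z (m n : podles A) :
    f (incl (z *: m + n)) = z *: f (incl m) + f (incl n).
  by rewrite !linearP.
have [r [s [t [cm c0 cp [hr hs ht]]]]] := podles_rows del_covariant
  (fun m => line_coord line1 (del_incl m))
  (fun f f' w => @line_uniq _ _ _ f f' w line1) (ul del) del1.
have [r' [s' [t' [cm' c0' cp' [hr' hs' ht']]]]] := podles_rows delbar_covariant
  (fun m => line_coord line1' (delbar_incl m))
  (fun f f' w => @line_uniq _ _ _ f f' w line1') (ul delbar) delbar1.
have nat0 n (z : C) : n.+1%:R * z = 0 -> z = 0.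
  by move/eqP; rewrite mulf_eq0 pnatr_eq0 => /eqP.
have sqr2 : 2 ^ 2 = 4 :> C by rewrite -[LHS]/(2 * 2); ring.
have sqr2V : 2 ^ (-2) = 2^-1 * 2^-1 :> C.
  by rewrite -invr_expz sqr2; field.
have r0 : r = 0.
  apply: (nat0 14); transitivity (4 * (2 ^ 2 * r - 2^-1 / 2 * r)).
    by rewrite sqr2; field.
  by rewrite hr subrr mulr0.
have s0 : s = 0.
  apply: (nat0 2); transitivity (2 ^ 2 * s - s); first by rewrite sqr2; ring.
  by rewrite -hs subrr.
have s0' : s' = 0.
  apply: (nat0 2); transitivity (4 * (s' - 2 ^ (-2) * s')).
    by rewrite sqr2V; field.
  by rewrite -hs' subrr mulr0.
have t0' : t' = 0.
  apply: (nat0 14); transitivity (4 * (2 * 2 * t' - 2 ^ (-2) * t')).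
    by rewrite sqr2V; field.
  by rewrite ht' subrr mulr0.
move: cm c0 cp cm' c0' cp'; rewrite r0 s0 s0' t0' !scale0r !add0r !addr0.
move=> cm c0 cp cm' c0' cp'.
have [ea eb ec ed] := eps_gen A.
have epsE (z : C) x y : eps (z *: (x * y)) = z * (eps x * eps y) :> C.
  by rewrite linearZ rmorphM.
have t1 : t = 1.
  apply: (line_scalar line1) => W f fB fN y.
  rewrite [in RHS]/e_plus db_d_split (bilinear_Dr fB).
  rewrite (coord_eps _ fB fN cp) (coord_eps _ fB fN cp') !epsE ec ed.
  by rewrite !mulr0 mulr1 scale0r addr0 mulr1.
have r1' : r' = 1.
  apply: (line_scalar line1') => W f fB fN y.
  rewrite [in RHS]/e_minus db_d_split (bilinear_Dr fB).
  rewrite (coord_eps _ fB fN cm) (coord_eps _ fB fN cm') !epsE ea eb.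
  by rewrite !mulr0 mulr1 scale0r add0r mulr1.
by move: cm c0 cp cm' c0' cp'; rewrite t1 r1' !scale1r.
Qed.

Lemma leibniz0 m w : dd (incl m * w) = dd (incl m) * w + incl m * dd w.
Proof.
have f0 : cl_form (c := Om) 0 (incl m) by rewrite cl_form0; exists m.
by rewrite (cl_leibniz w f0) scale1r.
Qed.

Lemma del_delbar_leibniz m n :
  del (incl m * incl n) = del (incl m) * incl n + incl m * del (incl n) /\
  delbar (incl m * incl n) =
    delbar (incl m) * incl n + incl m * delbar (incl n).
Proof.
have add p r x y : bi p r x -> bi p r y -> bi p r (x + y).
  by move=> bx bY; rewrite -[x]scale1r; exact: (proj2 (bi_subspace _ _)).
have b1 : bi 1 0 (del (incl m) * incl n + incl m * del (incl n)).
  apply: add; first exact: (bi_mul (del_incl m) (bi_incl n)).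
  exact: (bi_mul (bi_incl m) (del_incl n)).
have b1' : bi 0 1 (delbar (incl m) * incl n + incl m * delbar (incl n)).
  apply: add; first exact: (bi_mul (delbar_incl m) (bi_incl n)).
  exact: (bi_mul (bi_incl m) (delbar_incl n)).
have bmn : bi 0 0 (incl m * incl n) by exact: (bi_mul (bi_incl m) (bi_incl n)).
have sub p r x y : bi p r x -> bi p r y -> bi p r (x - y).
  by move=> bx bY; apply: subspaceB => //; exact: bi_subspace.
have [|_ /subr0_eq ? /subr0_eq ? _] := bi_indep (proj1 (bi_subspace 0 0))
    (sub _ _ _ _ (db_del_bi bmn) b1) (sub _ _ _ _ (db_delbar_bi bmn) b1')
    (proj1 (bi_subspace 1 1)); last by split.
rewrite add0r addr0; have := leibniz0 m (incl n); rewrite !db_d_split => e.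
rewrite [LHS](AC (2*2) ((1*3)*(2*4))) /= e mulrDl mulrDr -opprD.
by rewrite [X in X - _](AC (2*2) ((1*3)*(2*4))) /= subrr.
Qed.

(** Associativity (w m) v = w (m v), for v of type (0,1), determines the right
    action of M on forms of type (1,0). *)
Lemma coord_rmul10 f w m : E 2 f -> coord f ep w ->
  coord (f * \val m) ep (w * incl m).
Proof.
move=> Ef fw; have line1 := db_form10 Om; have line1' := db_form01 Om.
have bw := line_mem line1 Ef fw.
have [f' Ef' fw'] := line_coord line1 (bi_mul bw (bi_incl m)).
suff <- : f' = f * \val m by [].
apply: lower_cancel => // g Eg; have [v bv gv] := line_form line1' Eg.
have Emg : E (-2) (\val m * g) := degree_partM (podles_degree m) Eg.
have [fgv _] := db_wedge_pm Ef Emg fw (coord_lmul m gv).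
have [fgv' _] := db_wedge_pm Ef' Eg fw' gv.
rewrite -mulrA; apply: line_uniq (db_form11 Om) fgv' _.
by rewrite -mulrA.
Qed.

Lemma coord_rmul01 g v m : E (-2) g -> coord g em v ->
  coord (g * \val m) em (v * incl m).
Proof.
move=> Eg gv; have line1 := db_form10 Om; have line1' := db_form01 Om.
have bv := line_mem line1' Eg gv.
have [g' Eg' gv'] := line_coord line1' (bi_mul bv (bi_incl m)).
suff <- : g' = g * \val m by [].
apply: raise_cancel => // f Ef; have [w bw fw] := line_form line1 Ef.
have Emf : E 2 (\val m * f) := degree_partM (podles_degree m) Ef.
have [_ fgv] := db_wedge_pm Emf Eg (coord_lmul m fw) gv.
have [_ fgv'] := db_wedge_pm Ef Eg' fw gv'.
rewrite -mulrA; apply: (@scalerI _ _ (- q ^+ 2)).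
  by rewrite oppr_eq0 expf_neq0.
by apply: line_uniq (db_form11 Om) fgv' _; rewrite -mulrA.
Qed.


Lemma scaling_degree0 (y : A) : E 0 y -> scaling A q y = y.
Proof. by move=> /(scaling_degree q0)->; rewrite expr0z scale1r. Qed.

Lemma raising_lowering_gens :
  [/\ raising A q0 (a * b) = q *: (b * b), raising A q0 (b * c) = b * d
    & raising A q0 (c * d) = q *: (d * d)] /\
  [/\ lowering A q0 (a * b) = a * a, lowering A q0 (b * c) = c * a
    & lowering A q0 (c * d) = c * c].
Proof.
have [ra rb rc rd] := raising_gen A q0; have [la lb lc ld] := lowering_gen A q0.
have [ta tb tc td] := scaling_gen A q0.
rewrite !raisingM !loweringM ra rb rc rd la lb lc ld tb tc td.
by rewrite !mulr0 !mul0r !add0r !addr0 -!scalerAr (mulca A q0).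
Qed.

(** Both sides are derivations on the sphere, equal on generators. *)
Lemma del_delbar_coord (m : podles A) :
  coord (q^-1 *: raising A q0 (\val m)) ep (del (incl m)) /\
  coord (lowering A q0 (\val m)) em (delbar (incl m)).
Proof.
suff H x : sphere x -> forall m : podles A, \val m = x ->
    coord (q^-1 *: raising A q0 x) ep (del (incl m)) /\
    coord (lowering A q0 x) em (delbar (incl m)).
  exact: (H _ (degree0_sphere q0 (podles_degree m)) m erefl).
have [[cm c0 cp] [cm' c0' cp']] := del_delbar_generators.
have [[rm r0 rp] [lm l0 lp]] := raising_lowering_gens.
have ind (y : A) (m1 m2 : podles A) : \val m1 = y -> \val m2 = y -> m1 = m2.
  by move=> <- e; apply: val_inj.
have lin z (m1 m2 : podles A) (f : {linear Om -> Om}) :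
    f (incl (z *: m1 + m2)) = z *: f (incl m1) + f (incl m2).
  by rewrite !linearP.
elim=> {x} [||||z x y sx IHx sy IHy|x y sx IHx sy IHy] {}m mE.
- have -> : m = 1 by exact: val_inj.
  rewrite raising1 lowering1 scaler0; have [-> ->] := del_delbar1.
  by split; exact: coord_zero.
- rewrite (ind _ m (podles_bm A) mE erefl) rm lm scalerA mulVf // scale1r.
  by [].
- by rewrite (ind _ m podles_b0 mE erefl) r0 l0 -(muldb A q0).
- by rewrite (ind _ m (podles_bp A) mE erefl) rp lp scalerA mulVf // scale1r.
- have [mx mxE] : exists mx : podles A, \val mx = x.
    by exists (podles_of (sphere_degree0 sx)).
  have [my myE] : exists my : podles A, \val my = y.
    by exists (podles_of (sphere_degree0 sy)).
  have [cx lx] := IHx mx mxE; have [cy ly] := IHy my myE.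
  have -> : m = z *: mx + my by apply: val_inj; rewrite mE -mxE -myE.
  rewrite !lin (linearP (raising A q0)) (linearP (lowering A q0)).
  split; last exact: coord_lin.
  by rewrite scalerDr scalerA mulrC -scalerA; exact: coord_lin.
have [Ex Ey] := (sphere_degree0 sx, sphere_degree0 sy).
have [mx mxE] : exists mx : podles A, \val mx = x by exists (podles_of Ex).
have [my myE] : exists my : podles A, \val my = y by exists (podles_of Ey).
have [cx lx] := IHx mx mxE; have [cy ly] := IHy my myE.
have -> : m = mx * my by apply: val_inj; rewrite mE -mxE -myE.
have -> : incl (mx * my) = incl mx * incl my by exact: rmorphM.
rewrite raisingM loweringM (scaling_degree0 Ey); have [-> ->] :=
  del_delbar_leibniz mx my.
have Erx : E 2 (q^-1 *: raising A q0 x) by apply/degreeZ/(raising_degree q0 Ex).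
have Elx : E (-2) (lowering A q0 x) by exact: (lowering_degree q0 Ex).
split; rewrite addrC ?scalerDr.
  apply: coordD; first by rewrite scalerAl -myE; exact: coord_rmul10.
  by rewrite scalerAr -mxE; exact: coord_lmul.
apply: coordD; first by rewrite -myE; exact: coord_rmul01.
by rewrite -mxE; exact: coord_lmul.
Qed.

Lemma delbar_leibniz10 (m : podles A) w : bi 1 0 w ->
  delbar (incl m * w) = delbar (incl m) * w + incl m * delbar w.
Proof.
move=> bw; have bmw : bi 1 0 (incl m * w) := bi_mul (bi_incl m) bw.
rewrite -(d_del bmw) leibniz0 (d_del bw) db_d_split mulrDl.
by rewrite (bi20 (bi_mul (del_incl m) bw)) add0r.
Qed.

Lemma coord_delbar_mul (m : podles A) f w f' : E 2 f -> coord f ep w ->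
  coord f' tau (delbar w) ->
  coord (- q ^+ 2 *: (lowering A q0 (\val m) * f) + \val m * f') tau
    (delbar (incl m * w)).
Proof.
move=> Ef fw fw'; have bw := line_mem (db_form10 Om) Ef fw.
have [_ lm] := del_delbar_coord m.
have Elm : E (-2) (lowering A q0 (\val m)).
  exact: (lowering_degree q0 (podles_degree m)).
rewrite delbar_leibniz10 //; apply: coordD; last exact: coord_lmul.
by have [_] := db_wedge_pm Ef Elm fw lm.
Qed.

(** In degree 0 only s survives, and s = -1.  The relation
    b_- del b_+ = q^2 (ad) del b_0 holds since ab dd = q^2 ad db; applying delbar
    and taking the counit of the coordinates gives - q^2 = q^2 s. *)
Lemma delbar_del_generators :
  [/\ coord (- lowering A q0 (b * b)) tau (delbar (del (incl (podles_bm A)))),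
      coord (- lowering A q0 (d * b)) tau (delbar (del (incl podles_b0)))
    & coord (- lowering A q0 (d * d)) tau (delbar (del (incl (podles_bp A))))].
Proof.
have line1 := db_form10 Om; have line2 := db_form11 Om.
have [[cm c0 cp] _] := del_delbar_generators.
have u1 : delbar (del (incl 1)) = 0.
  by have [-> _] := del_delbar1; rewrite linear0.
have [r [s [t [Lm L0 Lp [hr _ ht]]]]] := podles_rows delbar_del_covariant
  (fun m => line_coord line2 (db_delbar_bi (del_incl m)))
  (fun f f' w => @line_uniq _ _ _ f f' w line2)
  (fun z m n => etrans (congr1 delbar (congr1 del (linearP incl z m n)))
     (linearP (delbar \o del) z (incl m) (incl n))) u1.
have nat0 n (z : C) : n.+1%:R * z = 0 -> z = 0.
  by move/eqP; rewrite mulf_eq0 pnatr_eq0 => /eqP.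
have r0 : r = 0.
  apply: (nat0 2); transitivity (4 * (2 ^ 0 * r - 2^-1 / 2 * r)).
    by rewrite expr0z; field.
  by rewrite hr subrr mulr0.
have t0 : t = 0.
  apply: (nat0 2); transitivity (2 * 2 * t - 2 ^ 0 * t).
    by rewrite expr0z; ring.
  by rewrite ht subrr.
move: Lm L0 Lp; rewrite r0 t0 !scale0r !add0r !addr0 => Lm L0 Lp.
have [db dd'] := (degree_part_b A, degree_part_d A).
have Eddd : E 2 (d * d) := degree_partM dd' dd'.
have Edb : E 2 (d * b) := degree_partM dd' db.
have [ea eb ec ed] := eps_gen A.
have epsZ (z : C) x : eps (z *: x) = z * eps x :> C by rewrite linearZ.
have rel : incl (podles_bm A) * del (incl (podles_bp A)) =
    q ^+ 2 *: (incl podles_ad * del (incl podles_b0)).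
  apply: (@coord_inj (a * b * (d * d)) ep); first exact: (coord_lmul (podles_bm
    A) cp).
  have -> : a * b * (d * d) = q ^+ 2 *: (a * d * (d * b)).
    have -> : a * b * (d * d) = a * (b * d) * d by rewrite !mulrA.
    rewrite mulbd -scalerAr -scalerAl.
    have -> : a * (d * b) * d = a * d * (b * d) by rewrite !mulrA.
    by rewrite mulbd -scalerAr scalerA.
  exact/coordZ/(coord_lmul podles_ad c0).
have s1 : s = -1.
  have := coord_delbar_mul (podles_bm A) Eddd cp Lp.
  have Er := coordZ (q ^+ 2) (coord_delbar_mul podles_ad Edb c0 L0).
  rewrite rel (linearZZ delbar) => El.
  have := congr1 (fun x => eps x : C) (line_uniq line2 El Er).
  have [_ [lm _ _]] := raising_lowering_gens; rewrite lm.
  rewrite -[\val (podles_bm A)]/(a * b) -[\val podles_ad]/(a * d).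
  have epsD x y : eps (x + y) = eps x + eps y :> C by exact: linearD.
  have epsM x y : eps (x * y) = eps x * eps y :> C by exact: rmorphM.
  rewrite !(epsZ, epsD, epsM) ea eb ec ed !(mulr0, mul0r, mulr1, mul1r).
  move=> e; apply: (mulfI (expf_neq0 2 q0)).
  by move: e; rewrite mulrN1 !(add0r, addr0) => ->; rewrite ?mulr1.
have [ra rb rc rd] := lowering_gen A q0; have [ta tb tc td] := scaling_gen A q0.
rewrite !loweringM rb rd tb td -!scalerAr.
move: Lm L0 Lp; rewrite s1 !scaleN1r => Lm L0 Lp; split.
- by rewrite addrC.
- by rewrite addrC.
- by rewrite addrC.
Qed.

(** Write f = f 1 with 1 expanded by one_lower_raise: thus w is a combination of
    the del b_i with coefficients in M, and both delbar and - F satisfy the same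
    Leibniz rule for left multiplication by M. *)
Lemma delbar_coord f w : E 2 f -> coord f ep w ->
  coord (- lowering A q0 f) tau (delbar w).
Proof.
move=> Ef fw; have [[cm c0 cp] _] := del_delbar_generators.
have [Lm L0 Lp] := delbar_del_generators.
have [da db] := (degree_part_a A, degree_part_b A).
have [dc dd'] := (degree_part_c A, degree_part_d A).
have pod g : E (-2) g -> exists m : podles A, \val m = f * g.
  move=> Eg; have Efg : E 0 (f * g) := degree_partM Ef Eg.
  by exists (podles_of Efg).
have [maa maaE] := pod _ (degree_partM da da).
have [mac macE] := pod _ (degree_partM da dc).
have [mca mcaE] := pod _ (degree_partM dc da).
have [mcc mccE] := pod _ (degree_partM dc dc).
have Fmul (m : podles A) x v : E 2 x -> coord x ep v ->
    coord (- lowering A q0 x) tau (delbar v) ->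
    coord (- lowering A q0 (\val m * x)) tau (delbar (incl m * v)).
  move=> Ex xv Lx; have := coord_delbar_mul m Ex xv Lx.
  congr (coord _ _ _); rewrite loweringM (scaling_degree q0 Ex) opprD addrC.
  by rewrite mulrN -scalerAr scaleNr.
have Ebb : E 2 (b * b) := degree_partM db db.
have Edb : E 2 (d * b) := degree_partM dd' db.
have Eddd : E 2 (d * d) := degree_partM dd' dd'.
have fE : f = \val maa * (d * d) + (- q) *: (\val (q *: mac + mca) * (d * b)) +
    (q * q) *: (\val mcc * (b * b)).
  have -> : \val (q *: mac + mca) = q *: (f * (a * c)) + f * (c * a).
    by rewrite -macE -mcaE.
  rewrite maaE mccE -[LHS]mulr1 (one_lower_raise A) mulbd.
  rewrite !(mulrBr, mulrDr) mulrDl scalerDr -!scalerAr -!scalerAl !scaleNr !mulrA.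
  by rewrite addrA.
have wE : w = incl maa * del (incl (podles_bp A)) +
    (- q) *: (incl (q *: mac + mca) * del (incl podles_b0)) +
    (q * q) *: (incl mcc * del (incl (podles_bm A))).
  apply: (coord_inj fw); rewrite {1}fE.
  by apply: coordD; [apply: coordD|]; try apply: coordZ; exact: coord_lmul.
have -> : - lowering A q0 f = - lowering A q0 (\val maa * (d * d)) +
    (- q) *: - lowering A q0 (\val (q *: mac + mca) * (d * b)) +
    (q * q) *: - lowering A q0 (\val mcc * (b * b)).
  rewrite {1}fE !(linearD (lowering A q0)) !(linearZZ (lowering A q0)).
  by rewrite !opprD !scalerN.
rewrite wE !(linearD delbar) !(linearZZ delbar).
by apply: coordD; [apply: coordD|]; try apply: coordZ; exact: Fmul.
Qed.

Lemma delbar_del_coord (m : podles A) :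
  coord (- q^-1 *: lowering A q0 (raising A q0 (\val m))) tau
    (delbar (del (incl m))).
Proof.
have [cm _] := del_delbar_coord m.
have Er : E 2 (q^-1 *: raising A q0 (\val m)).
  exact/degreeZ/(raising_degree q0 (podles_degree m)).
by have := delbar_coord Er cm; rewrite linearZZ scaleNr.
Qed.

End Dolbeault.

(** * Hodge theory of the Podles sphere *)
Section Hodge.
Variables (C : numClosedFieldType) (q : C) (A : CqSU2 q).
Hypothesis q0 : q != 0.
Variables (Om : dolbeault_complex A) (h : {linear Om -> Om}).
Hypothesis hP : is_hodge h.

Local Notation E := (@degree_part C q A).
Local Notation coord := (is_coord (@db_delta C q A Om)).
Local Notation incl := (cl_in Om).
Local Notation del := (db_del Om).
Local Notation delbar := (db_delbar Om).
Local Notation bi := (@db_bi C q A Om).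
Local Notation raise := (raising A q0).
Local Notation lower := (lowering A q0).

Lemma hodge_incl m : coord (\val m) (form_tau Om) (h (incl m)).
Proof. by case: hP. Qed.

Lemma hodge_top (m : podles A) w :
  coord (\val m) (form_tau Om) w -> h w = incl m.
Proof. by case: hP => _ + _ _; apply. Qed.

Lemma bi11_coord w : bi 1 1 w ->
  exists m : podles A, coord (\val m) (form_tau Om) w.
Proof.
by case/(line_coord (db_form11 Om)) => f Ef fw; exists (podles_of Ef).
Qed.

Lemma hodge_bi00 w : bi 0 0 w -> bi 1 1 (h w) /\ h (h w) = w.
Proof.
move=> /bi00E[m ->]; split; last exact: hodge_top (hodge_incl m).
exact: line_mem (db_form11 Om) (podles_degree m) (hodge_incl m).
Qed.

Lemma hodge_bi11 w : bi 1 1 w -> bi 0 0 (h w) /\ h (h w) = w.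
Proof.
move=> /bi11_coord[m mw]; rewrite (hodge_top mw); split; first exact: bi_incl.
exact: coord_inj (hodge_incl m) mw.
Qed.

Lemma hodge_delbar_del (m m' : podles A) : \val m' = lower (raise (\val m)) ->
  h (delbar (del (incl m))) = - q^-1 *: incl m'.
Proof.
move=> m'E; rewrite -(linearZZ incl); apply: hodge_top.
by have := delbar_del_coord q0 m; rewrite -m'E.
Qed.

Lemma lower_raise (m : podles A) :
  exists m' : podles A, \val m' = lower (raise (\val m)).
Proof.
have := lowering_degree q0 (raising_degree q0 (podles_degree m)).
by rewrite addrK => Em; exists (podles_of Em).
Qed.

Lemma bi00_eigen_sum w : bi 0 0 w ->
  eigen_sum (bi 0 0) (fun v => - 'i *: h (delbar (del v))) w.
Proof.
move=> /bi00E[m ->].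
have := degree0_eigen_sum q0 (podles_degree m); move xE : (\val m) => x xs.
elim: xs m xE => [|z u x' Eu eu _ IH] m mE.
  have -> : m = 0 by apply: val_inj.
  by rewrite linear0; exact: eigen_sum0.
have [mu muE] : exists mu : podles A, \val mu = u by exists (podles_of Eu).
have -> : m = mu + (m - mu) by rewrite addrC subrK.
rewrite linearD; apply: (eigen_sum_add (z := 'i * q^-1 * z)).
- exact: bi_incl.
- rewrite (@hodge_delbar_del mu (z *: mu)); last by rewrite muE -[RHS]/((lower \o
    raise) u) eu -muE.
  by rewrite (linearZZ incl) !scalerA mulrNN.
apply: IH; rewrite -[LHS]/(\val m - \val mu) mE muE.
by rewrite addrC addKr.
Qed.

Lemma bi00_kernel w : bi 0 0 w -> h (delbar (del w)) = 0 ->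
  del w = 0 /\ delbar w = 0.
Proof.
move=> /bi00E[m ->]; have [m' m'E] := lower_raise m.
rewrite (hodge_delbar_del m'E) => /eqP.
rewrite scaler_eq0 oppr_eq0 invr_eq0 (negPf q0) => /eqP m'_0.
have m'0 : m' = 0 by apply: (@cl_in_inj _ _ _ Om); rewrite linear0.
have [r0 l0] : raise (\val m) = 0 /\ lower (\val m) = 0.
  by apply: lowering_raising_ker (podles_degree m) _; rewrite -m'E m'0.
have [] := del_delbar_coord q0 Om m; rewrite r0 l0 scaler0 => c1 c2.
by split; [exact: coord_inj c1 (coord_zero _) | exact: coord_inj c2 (coord_zero _)].
Qed.

Lemma bi10_exact v : bi 1 0 v -> exists2 w, bi 0 0 w & v = del w.
Proof.
case/(line_coord (db_form10 Om)) => f Ef fv.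
have [x Ex fE] := raising_onto q0 Ef.
pose m := podles_of (degreeZ q Ex); exists (incl m); first exact: bi_incl.
apply: coord_inj fv _; have [+ _] := del_delbar_coord q0 Om m.
by rewrite -[\val m]/(q *: x) (linearZZ raise) scalerA mulVf // scale1r -fE.
Qed.

Lemma bi01_exact v : bi 0 1 v -> exists2 w, bi 0 0 w & v = delbar w.
Proof.
case/(line_coord (db_form01 Om)) => f Ef fv.
have [x Ex fE] := lowering_onto q0 Ef.
exists (incl (podles_of Ex)); first exact: bi_incl.
apply: coord_inj fv _; have [_ +] := del_delbar_coord q0 Om (podles_of Ex).
by rewrite -[\val _]/x -fE.
Qed.

Lemma del_delbar_anticomm w : bi 0 0 w -> del (delbar w) = - delbar (del w).
Proof.
move=> bw; apply/eqP; rewrite -addr_eq0 addrC.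
rewrite -(d_del (db_del_bi bw)) -(d_delbar (db_delbar_bi bw)).
by rewrite -linearD -db_d_split cl_dd.
Qed.

Theorem podles_hodge_theory :
  [/\ hodge_theory (cl_d Om) (hodge_conj h (cl_d Om)),
      hodge_theory del (hodge_conj h delbar)
    & hodge_theory delbar (hodge_conj h del)].
Proof.
apply: (@kaehler_hodge_theory _ _ _ _ _ _ (bi 0 0) (bi 1 0) (bi 0 1) (bi 1 1)).
- exact: bi_span.
- exact: bi_indep.
- by split; exact: bi_subspace.
- exact: db_d_split.
- by move=> v /db_del_bi.
- by move=> v /db_delbar_bi.
- by move=> v /db_del_bi/bi20.
- by move=> v /db_delbar_bi.
- by move=> v /db_del_bi.
- by move=> v /db_delbar_bi/bi02.
- by move=> v /db_del_bi/bi_gt2; apply.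
- by move=> v /db_delbar_bi/bi_gt2; apply.
- exact: del_delbar_anticomm.
- by move=> v /hodge_bi00[].
- by move=> v /hodge_bi11[].
- by move=> v /hodge_bi00[].
- by move=> v /hodge_bi11[].
- move=> v /(line_coord (db_form10 Om))[f Ef fv].
  by have [_ _ hP10 _] := hP; exact: hP10 Ef fv.
- move=> v /(line_coord (db_form01 Om))[g Eg gv].
  by have [_ _ _ hP01] := hP; exact: hP01 Eg gv.
- exact: bi00_eigen_sum.
- exact: bi00_kernel.
- exact: bi10_exact.
- exact: bi01_exact.
Qed.

End Hodge.

Theorem theorem3p5 (R : realType) (q : R[i]) (hq : q != 0)
    (A : CqSU2 q) (Om : dolbeault_complex A)
    (hodge : {linear Om -> Om}) (hodgeP : is_hodge hodge) :
  let d : Om -> Om := cl_d Om in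
  let del : Om -> Om := db_del Om in
  let delbar : Om -> Om := db_delbar Om in
  let ds := codiff hodge d in
  let dels := codiff hodge delbar in
  let delbars := codiff hodge del in
  let D_d := dirac d ds in
  let D_del := dirac del dels in
  let D_delbar := dirac delbar delbars in
  let Delta_d := laplacian d ds in
  let Delta_del := laplacian del dels in
  let Delta_delbar := laplacian delbar delbars in
  let H_d := kernel Delta_d in
  let H_del := kernel Delta_del in
  let H_delbar := kernel Delta_delbar in
  [/\ [/\ diagonalisable D_d, diagonalisable D_del & diagonalisable D_delbar]
      /\ [/\ diagonalisable Delta_d, diagonalisable Delta_del
           & diagonalisable Delta_delbar],
      [/\ kernel Delta_d = kernel D_d /\ kernel D_d = kernel d `&` kernel ds,
          kernel Delta_del = kernel D_del /\
            kernel D_del = kernel del `&` kernel dels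
        & kernel Delta_delbar = kernel D_delbar /\
            kernel D_delbar = kernel delbar `&` kernel delbars]
    & [/\ direct_sum3 H_d (range d) (range ds),
          direct_sum3 H_del (range del) (range dels)
        & direct_sum3 H_delbar (range delbar) (range delbars)]].
Proof.
have [[? ? ? ? ?] [? ? ? ? ?] [? ? ? ? ?]] := podles_hodge_theory hq hodgeP.
by split; split.
Qed.
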